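(* Let $N$ be a smooth manifold, let $Q$ be a positive definite $C^{2}$ quadratic form on $TN$, and let $\rho$ be the Riemannian metric on $N$ with $Q_x(v)=\Vert v\Vert_x^{2}/2$. Let $k\ge 1$ with $k<\dim N$, let $g:\mathbb{R}^{k}\to\mathbb{R}$ be a $C^{2}$ nonnegative function vanishing only at the origin, and let $F=(F_1,\ldots,F_k):N\to\mathbb{R}^{k}$ be a $C^{3}$ function such that $\mathbf{0}$ is a regular value of $F$, the vector fields $\nabla_\rho F_i/\Vert\nabla_\rho F_i\Vert^{2}$ pairwise commute, and $\langle \nabla_\rho F_i,\nabla_\rho F_j\rangle_\rho\equiv 0$ for $i\neq j$. Put $U=g\circ F$ and $M=U^{-1}(0)$. Let $$\mu=F^{*}(\omega),\qquad \omega\in\Omega^{1}(\mathbb{R}^{k}),$$ be the pullback by $F$ of any (smooth) one-form $\omega$ on $\mathbb{R}^{k}$. Then every point of $M\times\{\mathbf{0}\}\subset TN$ is a Lyapunov unstable equilibrium point of the Lagrangian dynamics (Euler-Lagrange flow on $TN$) of $L(x,v)=Q_x(v)+\mu_x(v)-U(x)$. Moreover, if $d\omega$ is non null at $\mathbf{0}$, then $d\mu$ is non null at every point of $M$. In particular, if $k>1$, there are one-forms $\omega\in\Omega^{1}(\mathbb{R}^{k})$ such that for $\mu=F^{*}(\omega)$ the magnetic field $d\mu$ is non null at every point of $M$.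
   Context: $\nabla_\rho$ denotes the gradient with respect to $\rho$. The vector field $\nabla_\rho F_i/\Vert\nabla_\rho F_i\Vert^{2}$ is defined off the critical set of $F_i$, and commutation is understood wherever the fields are defined. $\Omega^{1}(\mathbb{R}^{k})$ is the space of smooth differential one-forms on $\mathbb{R}^{k}$. $M\times\{\mathbf{0}\}$ is the set of $(x,\mathbf{0})\in TN$ with $x\in M$. An equilibrium point $(p,\mathbf{0})$ is Lyapunov stable if for every neighborhood $\mathcal{O}$ of it in $TN$ there is a neighborhood $\mathcal{O}'$ of it such that every solution $(x(t),\dot x(t))$ of the Euler-Lagrange equations with $(x(0),\dot x(0))\in\mathcal{O}'$ is defined and stays in $\mathcal{O}$ for all $t\ge 0$; it is Lyapunov unstable if it is not Lyapunov stable. *)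

(* Defs.v *)
From HB Require Import structures.
From mathcomp Require Import all_boot all_order all_algebra.
From mathcomp Require Import all_classical all_reals all_analysis.

Set Implicit Arguments.
Unset Strict Implicit.
Unset Printing Implicit Defensive.

Import Order.TTheory GRing.Theory Num.Theory.
Import numFieldNormedType.Exports.

Local Open Scope classical_set_scope.
Local Open Scope ring_scope.

(* [Cr r A f]: f is of class C^r on A.  Meant for A open and V
   finite-dimensional, where continuity of x |-> 'd f x amounts to continuity
   of x |-> 'd f x v for every v.  The values of f off A are irrelevant. *)
Fixpoint Cr (R : realType) (V W : normedModType R) (r : nat) (A : set V)
    (f : V -> W) : Prop :=
  match r with
  | 0 => forall x, A x -> {for x, continuous f}
  | r'.+1 => (forall x, A x -> differentiable f x) /\
             (forall v : V, Cr r' A (fun x => 'd f x v))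
  end.

Definition smooth (R : realType) (V W : normedModType R) (A : set V)
  (f : V -> W) : Prop := forall r, Cr r A f.

Record chart (R : realType) (n : nat) (N : topologicalType) := Chart {
  dom : set N;
  cmap : N -> 'rV[R]_n;
  cinv : 'rV[R]_n -> N;
  dom_open : open dom;
  img_open : open (cmap @` dom);
  cmapK : forall x, dom x -> cinv (cmap x) = x;
  cmap_cont : forall x, dom x -> {for x, continuous cmap};
  cinv_cont : forall y, (cmap @` dom) y -> {for y, continuous cinv}
}.

Definition img (R : realType) (n : nat) (N : topologicalType)
  (c : chart R n N) : set 'rV[R]_n := cmap c @` dom c.

(* A smooth n-manifold.  [chart_at x] is a chosen chart of the atlas around x;
   it only serves to name tangent vectors (see [TN]). *)
Record manifold (R : realType) (n : nat) := Manifold {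
  carrier :> topologicalType;
  manifold_hausdorff : hausdorff_space carrier;
  manifold_second_countable : @second_countable carrier;
  atlas : set (chart R n carrier);
  chart_at : carrier -> chart R n carrier;
  chart_at_atlas : forall x, atlas (chart_at x);
  chart_at_dom : forall x, dom (chart_at x) x;
  atlas_compat : forall c d, atlas c -> atlas d ->
    smooth (cmap c @` (dom c `&` dom d)) (cmap d \o cinv c)
}.

Section Manifold.
Variables (R : realType) (n : nat) (N : manifold R n).
Implicit Types (c : chart R n N) (x : N) (v w : 'rV[R]_n) (y : 'rV[R]_n).

Definition CrM (W : normedModType R) (r : nat) (f : N -> W) : Prop :=
  forall c, atlas c -> Cr r (img c) (f \o cinv c).

(* The tangent space at x is R^n, a vector being given by its coordinates in
   [chart_at x].  The product topology on this type is NOT the topology of the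
   tangent bundle: neighborhoods are given by [nbhsTN]. *)
Definition TN : Type := (N * 'rV[R]_n)%type.

(* coordinates in the chart c of a tangent vector at x *)
Definition to_chart c x v : 'rV[R]_n :=
  'd (cmap c \o cinv (chart_at x)) (cmap (chart_at x) x) v.

(* tangent vector at [cinv c y] with coordinates w in the chart c *)
Definition from_chart c y w : 'rV[R]_n :=
  'd (cmap (chart_at (cinv c y)) \o cinv c) y w.

Definition TNinv c (q : 'rV[R]_n * 'rV[R]_n) : TN :=
  (cinv c q.1, from_chart c q.1 q.2).

Definition nbhsTN (z : TN) (O : set TN) : Prop :=
  let c := chart_at z.1 in
  \forall q \near ((cmap c z.1, z.2) : 'rV[R]_n * 'rV[R]_n), O (TNinv c q).

Definition CrTN (r : nat) (f : N -> 'rV[R]_n -> R) : Prop :=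
  forall c, atlas c ->
    Cr r [set q : 'rV[R]_n * 'rV[R]_n | img c q.1]
      (fun q => f (TNinv c q).1 (TNinv c q).2).

Definition tdiff (W : normedModType R) (f : N -> W) x v : W :=
  'd (f \o cinv (chart_at x)) (cmap (chart_at x) x) v.

Definition polar (q : 'rV[R]_n -> R) v w : R := q (v + w) - q v - q w.

Definition quadratic_form (q : 'rV[R]_n -> R) : Prop :=
  (forall a v, q (a *: v) = a ^+ 2 * q v) /\ (forall v, scalar (polar q v)).

Definition posdef_quadratic_on_TN (Q : N -> 'rV[R]_n -> R) : Prop :=
  forall x, quadratic_form (Q x) /\ (forall v, v != 0 -> 0 < Q x v).

(* The inner product with [Q x v] = |v|^2 / 2, by polarization: there is no
   factor 1/2 because of the 1/2 in Q. *)
Definition metric (Q : N -> 'rV[R]_n -> R) x v w : R := polar (Q x) v w.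

Definition grad (Q : N -> 'rV[R]_n -> R) (f : N -> R) x : 'rV[R]_n :=
  xget 0 [set u | forall w, metric Q x u w = tdiff f x w].

Definition normalized_grad (Q : N -> 'rV[R]_n -> R) (f : N -> R) x
    : 'rV[R]_n :=
  (metric Q x (grad Q f x) (grad Q f x))^-1 *: grad Q f x.

Definition lie_bracket (X Y : N -> 'rV[R]_n) x : 'rV[R]_n :=
  let c := chart_at x in
  let X' y := to_chart c (cinv c y) (X (cinv c y)) in
  let Y' y := to_chart c (cinv c y) (Y (cinv c y)) in
  let y := cmap c x in
  'd Y' y (X' y) - 'd X' y (Y' y).

Definition ext_deriv (mu : N -> 'rV[R]_n -> R) x v w : R :=
  let c := chart_at x in
  let mu' y u := mu (cinv c y) (from_chart c y u) in
  'd (mu' ^~ w : 'rV[R]_n -> R) (cmap c x) v -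
  'd (mu' ^~ v : 'rV[R]_n -> R) (cmap c x) w.

Definition regular_value k (F : N -> 'rV[R]_k) (a : 'rV[R]_k) : Prop :=
  forall x, F x = a -> forall u, exists v, tdiff F x v = u.

Definition local_lagrangian (L : N -> 'rV[R]_n -> R) c y w : R :=
  L (TNinv c (y, w)).1 (TNinv c (y, w)).2.

(* gamma restricted to the open set I is a C^2 solution of the Euler-Lagrange
   equations d/dt (dL/dw) = dL/dy, written in every chart *)
Definition EL_solution (L : N -> 'rV[R]_n -> R) (I : set R) (gamma : R -> N)
    : Prop :=
  (forall t, I t -> {for t, continuous gamma}) /\
  forall c, atlas c ->
    let J := [set t | I t /\ dom c (gamma t)] in
    let y : R -> 'rV[R]_n := cmap c \o gamma in
    let Lc := local_lagrangian L c in
    Cr 2 J y /\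
    forall t, J t -> forall v : 'rV[R]_n,
      is_derive t 1
        (fun s => 'D_v (fun w => Lc (y s) w) (derive1 y s))
        ('D_v (fun z => Lc z (derive1 y t)) (y t)).

Definition velocity_lift (gamma : R -> N) (t : R) : TN :=
  (gamma t, derive1 (cmap (chart_at (gamma t)) \o gamma : R -> 'rV[R]_n) t).

Definition maximal_EL_solution (L : N -> 'rV[R]_n -> R) (I : set R)
    (gamma : R -> N) : Prop :=
  [/\ open I, is_interval I, I 0, EL_solution L I gamma &
    forall (J : set R) (eta : R -> N),
      open J -> is_interval J -> I `<=` J -> EL_solution L J eta ->
      (forall t, I t -> eta t = gamma t) -> J `<=` I].

Definition equilibrium (L : N -> 'rV[R]_n -> R) (z : TN) : Prop :=
  exists gamma : R -> N,
    EL_solution L setT gamma /\ forall t, velocity_lift gamma t = z.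

Definition lyapunov_stable (L : N -> 'rV[R]_n -> R) (z : TN) : Prop :=
  forall O, nbhsTN z O -> exists O', nbhsTN z O' /\
    forall (I : set R) (gamma : R -> N),
      maximal_EL_solution L I gamma -> O' (velocity_lift gamma 0) ->
      forall t, 0 <= t -> I t /\ O (velocity_lift gamma t).

Definition lyapunov_unstable (L : N -> 'rV[R]_n -> R) (z : TN) : Prop :=
  ~ lyapunov_stable L z.

End Manifold.

Definition smooth_one_form (R : realType) (k : nat)
    (omega : 'rV[R]_k -> 'rV[R]_k -> R) : Prop :=
  (forall y, scalar (omega y)) /\
  (forall v, smooth setT (omega ^~ v : 'rV[R]_k -> R)).

Definition ext_deriv_Rk (R : realType) (k : nat)
    (omega : 'rV[R]_k -> 'rV[R]_k -> R) (y v w : 'rV[R]_k) : R :=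
  'd (omega ^~ w : 'rV[R]_k -> R) y v - 'd (omega ^~ v : 'rV[R]_k -> R) y w.

Definition pullback (R : realType) (n k : nat) (N : manifold R n)
    (F : N -> 'rV[R]_k) (omega : 'rV[R]_k -> 'rV[R]_k -> R)
    (x : N) (v : 'rV[R]_n) : R :=
  omega (F x) (tdiff F x v).

Definition non_null (R : realType) (m : nat)
    (eta : 'rV[R]_m -> 'rV[R]_m -> R) : Prop := exists v w, eta v w != 0.

Definition component (R : realType) (n k : nat) (N : manifold R n)
    (F : N -> 'rV[R]_k) (i : 'I_k) (x : N) : R := F x 0 i.

(* Main.v *)
Require Import Defs.
From HB Require Import structures.
From mathcomp Require Import all_boot all_order all_algebra.
From mathcomp Require Import all_classical all_reals all_analysis.
From mathcomp Require Import ring lra.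
Set Implicit Arguments.
Unset Strict Implicit.
Unset Printing Implicit Defensive.

Import Order.TTheory GRing.Theory Num.Theory.
Import numFieldNormedType.Exports.
Local Open Scope classical_set_scope.
Local Open Scope ring_scope.

(** Since k < dim N and 0 is a regular value, near p in M there is a C^1 vector
    field v tangent to the level sets of F with v(p) <> 0.  It annihilates both
    dU and mu, and i_v d(mu) = 0 because mu is pulled back by F, so along a
    motion x(t) the momentum P = <v, x'> satisfies P' = (L_v rho)(x', x') / 2 =
    O(|x'|^2).  The motion starting at p with velocity s v(p) has energy of
    order s^2, hence |x'| = O(s) while it stays near p.  Thus P(0) is of order s
    and P' = O(s^2): for times up to a constant over s the momentum keeps at
    least half of its initial value, and the motion drifts along v(p) by an
    amount independent of s.  Motions with these initial data exist by the
    Picard-Lindelof theorem in one chart, the invariance of the Euler-Lagrange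
    equations under changes of chart, and Zorn's lemma.  The form d(mu) is the
    pullback of d(omega) by the symmetry of the second derivative of F. *)

(** * Functions of class C^r *)

(** Energy confines slow motions transversally to the level sets of [F], so instability has to be
    found along them, which is where [k < dim N] enters. The obstacle is that the size of the escape
    must be fixed before the initial speed [s]: the slower the motion, the longer it has to be
    controlled, for times of order [1 / s]. Over such a time a rate quadratic in the velocity
    changes the momentum by an amount of order [s], comparable to the momentum itself and made small
    by the choice of constants, while a rate linear in the velocity would swamp it. Hence [v] has to
    annihilate the potential force and the magnetic force exactly. To turn momentum into
    displacement, [<v, .>] is frozen at [p]; this gives a linear function of the coordinates whose
    rate of change differs from the momentum by a small multiple of the speed. Stability is refuted
    by contradiction: it keeps the motion for all positive times in a small ball of one chart, where
    all estimates are made. As stability speaks of maximal solutions only, the local motion has to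
    be extended before it can be used. *)

Section Differential.
Context {R : realType}.
Implicit Types V W : normedModType R.

(** ['d] is obtained by choice, so congruence under local equality goes through uniqueness of the
    first-order expansion, which depends only on the values near [x]. *)
Lemma near_eq_is_diff V W (f g : V -> W) x :
  {near x, f =1 g} -> differentiable f x ->
  differentiable g x /\ 'd g x = 'd f x :> (V -> W).
Proof.
move=> fg df.
have [dfc dfE] : continuous ('d f x) /\
  f \o shift x = cst (f x) + 'd f x +o_ 0 id by exact/diff_locallyP.
suff H : g \o shift x = cst (g x) + 'd f x +o_ 0 id.
  have E : 'd g x = 'd f x :> (V -> W) by apply: diff_unique.
  split; last exact: E.
  by apply/diff_locallyP; rewrite E; split; [exact: dfc|exact: H].
have gx : g x = f x by apply/esym; exact: (nbhs_singleton fg).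
apply/eqaddoP => e e0.
move/eqaddoP : dfE => /(_ e e0).
have : \forall y \near (0:V), f (y + x) = g (y + x).
  have : \forall y \near x, f y = g y by exact: fg.
  by rewrite (near_shift 0) /= subr0.
apply: filterS2 => y E /=.
by rewrite !fctE /= -E gx.
Qed.

Lemma differentiable_rVP V m (f : V -> 'rV[R]_m) x :
  (forall i, differentiable (fun y => f y 0 i) x) -> differentiable f x.
Proof.
move=> df.
have -> : f = \sum_(i < m) (fun y => f y 0 i *: delta_mx 0 i).
  apply/funext => y; rewrite fct_sumE; exact: row_sum_delta.
by apply: differentiable_sum => i; exact/differentiableZl.
Qed.

Lemma is_diff_coord V m (f : V -> 'rV[R]_m) x i :
  differentiable f x ->
  is_diff x (fun y => f y 0 i) (fun v => 'd f x v 0 i).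
Proof.
move=> df.
pose p : 'rV[R]_m -> R := fun z => z 0 i.
have pl : linear p by move=> a u v; rewrite /p !mxE.
pose pM := GRing.isLinear.Build _ _ _ _ _ pl.
pose pL : {linear 'rV[R]_m -> R} := HB.pack p pM.
have pc : continuous pL by exact: coord_continuous.
have dp : differentiable pL (f x) by exact: linear_differentiable.
apply: DiffDef; first exact: (differentiable_comp df dp).
rewrite (_ : (fun y => _) = pL \o f) // diff_comp //.
by rewrite (diff_lin _ pc).
Qed.

Lemma diff_rVE V m (g : 'rV[R]_m -> V) y w :
  'd g y w = \sum_i w 0 i *: 'd g y (delta_mx 0 i).
Proof.
by rewrite {1}[w]row_sum_delta linear_sum; apply: eq_bigr => i _; rewrite linearZ.
Qed.

End Differential.

Section Cr_theory.
Context {R : realType}.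
Implicit Types V W : normedModType R.

Lemma Cr_ext V W r (A : set V) (g f : V -> W) :
  f =1 g -> Cr r A g -> Cr r A f.
Proof. by move=> /funext ->. Qed.

Lemma Cr_eq V W r (A : set V) (f g : V -> W) : open A ->
  (forall x, A x -> f x = g x) -> Cr r A f -> Cr r A g.
Proof.
move=> oA; elim: r f g => [|r IH] f g fg /=.
  move=> cf x Ax; rewrite /prop_for /continuous_at -fg //.
  apply: cvg_trans (cf x Ax).
  apply: near_eq_cvg; near=> z; apply: fg; near: z; exact: open_nbhs_nbhs.
move=> [df dfr].
have E x : A x -> differentiable g x /\ 'd g x = 'd f x :> (V -> W).
  move=> Ax; apply: near_eq_is_diff (df x Ax).
  by near=> z; apply: fg; near: z; exact: open_nbhs_nbhs.
split=> [x Ax|v]; first by case: (E x Ax).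
by apply: IH (dfr v) => x Ax; case: (E x Ax) => _ ->.
Unshelve. all: by end_near. Qed.

Lemma Cr_sub V W r (A B : set V) (f : V -> W) :
  B `<=` A -> Cr r A f -> Cr r B f.
Proof.
move=> BA; elim: r f => [|r IH] f /=; first by move=> cf x /BA /cf.
by move=> [df dfr]; split=> [x /BA /df //|v]; exact: IH.
Qed.

Lemma Cr_le V W r s (A : set V) (f : V -> W) : (s <= r)%N ->
  Cr r A f -> Cr s A f.
Proof.
elim: r s f => [|r IH] [|s] f //= rs.
  by move=> [df _] x Ax; exact/differentiable_continuous/df.
by move=> [df dfr]; split=> // v; exact: IH.
Qed.

(** [Cr] on a set is a condition at each of its points separately, so any set through the point can
    witness it. *)
Lemma Cr_local V W r (A : set V) (f : V -> W) :
  (forall x, A x -> exists2 B : set V, B x & Cr r B f) -> Cr r A f.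
Proof.
elim: r f => [|r IH] f H /=; first by move=> x /H[B Bx]; exact.
split=> [x /H[B Bx /= []]|v]; first by move=> + _; exact.
by apply: IH => x /H[B Bx /= [_ df]]; exists B.
Qed.

Lemma Cr_cst V W r (A : set V) (c : W) : Cr r A (fun=> c).
Proof.
elim: r c => [|r IH] c /=; first by move=> x _; exact: cvg_cst.
split=> [x _|v]; first exact: differentiable_cst.
rewrite (_ : (fun x => _) = fun=> 0); first exact: IH.
by apply/funext => x; rewrite diff_cst.
Qed.

Lemma Cr_lin V W r (A : set V) (f : {linear V -> W}) :
  continuous f -> Cr r A f.
Proof.
move=> cf; case: r => [|r] /=; first by move=> x _; exact: cf.
split=> [x _|v]; first exact: linear_differentiable.
rewrite (_ : (fun x => _) = fun=> f v); first exact: Cr_cst.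
by apply/funext => x; rewrite diff_lin.
Qed.

Lemma Cr_id V r (A : set V) : Cr r A (fun x => x).
Proof. by apply: (@Cr_lin _ _ r A idfun) => x; exact: cvg_id. Qed.

Lemma CrD V W r (A : set V) (f g : V -> W) : open A ->
  Cr r A f -> Cr r A g -> Cr r A (fun x => f x + g x).
Proof.
move=> oA; elim: r f g => [|r IH] f g /=.
  by move=> cf cg x Ax; apply: cvgD; [exact: cf|exact: cg].
move=> [df dfr] [dg dgr]; split=> [x Ax|v].
  by apply: differentiableD; [exact: df|exact: dg].
apply: Cr_eq (IH _ _ (dfr v) (dgr v)) => //= x Ax.
exact: esym (congr1 (@^~ v) (diffD (df x Ax) (dg x Ax))).
Qed.

Lemma CrN V W r (A : set V) (f : V -> W) : open A ->
  Cr r A f -> Cr r A (fun x => - f x).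
Proof.
move=> oA; elim: r f => [|r IH] f /=.
  by move=> cf x Ax; apply: cvgN; exact: cf.
move=> [df dfr]; split=> [x Ax|v].
  by apply: differentiableN; exact: df.
apply: Cr_eq (IH _ (dfr v)) => //= x Ax.
exact: esym (congr1 (@^~ v) (diffN (df x Ax))).
Qed.

Lemma CrB V W r (A : set V) (f g : V -> W) : open A ->
  Cr r A f -> Cr r A g -> Cr r A (fun x => f x - g x).
Proof. by move=> oA cf cg; apply: CrD => //; exact: CrN. Qed.

Lemma Cr_sum V W r (A : set V) I (s : seq I) (P : pred I) (f : I -> V -> W) :
  open A -> (forall i, P i -> Cr r A (f i)) ->
  Cr r A (fun x => \sum_(i <- s | P i) f i x).
Proof.
move=> oA cf; elim: s => [|i s IH].
  by apply: Cr_ext (Cr_cst _ _ 0) => x; rewrite big_nil.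
have [Pi|nPi] := boolP (P i); last first.
  by apply: Cr_ext IH => x; rewrite big_cons (negPf nPi).
apply: Cr_ext (CrD oA (cf i Pi) IH) => x.
by rewrite big_cons Pi.
Qed.

Lemma Cr_mul V r (A : set V) (f g : V -> R) : open A ->
  Cr r A f -> Cr r A g -> Cr r A (fun x => f x * g x).
Proof.
move=> oA; elim: r f g => [|r IH] f g.
  by move=> cf cg x Ax; apply: cvgM; [exact: cf|exact: cg].
move=> cf cg; have [df dfr] := cf; have [dg dgr] := cg.
split=> [x Ax|v].
  exact: (differentiableM (df x Ax) (dg x Ax)).
have lf := Cr_le (leqnSn r) cf; have lg := Cr_le (leqnSn r) cg.
apply: Cr_eq (CrD oA (IH _ _ lf (dgr v)) (IH _ _ lg (dfr v))) => //= x Ax.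
exact: esym (congr1 (@^~ v) (diffM (df x Ax) (dg x Ax))).
Qed.

Lemma CrZl V W r (A : set V) (f : V -> R) (w : W) : open A ->
  Cr r A f -> Cr r A (fun x => f x *: w).
Proof.
move=> oA; elim: r f => [|r IH] f /=.
  by move=> cf x Ax; apply: cvgZl; exact: cf.
move=> [df dfr]; split=> [x Ax|v].
  by apply: differentiableZl; exact: df.
apply: Cr_eq (IH _ (dfr v)) => //= x Ax.
by rewrite diffZl //; exact: df.
Qed.

Lemma Cr_coord V r (A : set V) m (f : V -> 'rV[R]_m) i : open A ->
  Cr r A f -> Cr r A (fun x => f x 0 i).
Proof.
move=> oA; elim: r f => [|r IH] f /=.
  move=> cf x Ax; apply: (@continuous_comp _ _ _ f (fun z : 'rV_m => z 0 i)).
    exact: cf.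
  exact: coord_continuous.
move=> [df dfr]; split=> [x Ax|v].
  by case: (is_diff_coord i (df x Ax)).
apply: Cr_eq (IH _ (dfr v)) => //= x Ax.
by case: (is_diff_coord i (df x Ax)) => _ ->.
Qed.

Lemma Cr_rV V r (A : set V) m (f : V -> 'rV[R]_m) : open A ->
  (forall i, Cr r A (fun x => f x 0 i)) -> Cr r A f.
Proof.
move=> oA cf.
rewrite (_ : f = fun x => \sum_i f x 0 i *: delta_mx 0 i); last first.
  by apply/funext => x; exact: row_sum_delta.
by apply: Cr_sum => // i _; exact: CrZl.
Qed.

(** Induction on [r]: in the standard basis the derivative of the composite is a finite sum of
    products of a coordinate of ['d f x v] with a partial derivative of [g] at [f x], and the
    induction hypothesis covers both factors. The middle space is ['rV_m] for the sake of this
    sum. *)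
Lemma Cr_comp V r (A : set V) m (B : set 'rV[R]_m) (f : V -> 'rV[R]_m)
    (g : 'rV[R]_m -> R) : open A ->
  (forall x, A x -> B (f x)) ->
  Cr r A f -> Cr r B g -> Cr r A (fun x => g (f x)).
Proof.
move=> oA AB; elim: r f g AB => [|r IH] f g AB.
  move=> cf cg x Ax; apply: (@continuous_comp _ _ _ f g); first exact: cf.
  exact/cg/AB.
move=> cf cg; have [df dfr] := cf; have [dg dgr] := cg.
split=> [x Ax|v].
  exact: (differentiable_comp (df x Ax) (dg _ (AB x Ax))).
have lf := Cr_le (leqnSn r) cf.
have H : Cr r A (fun x => \sum_i ('d f x v) 0 i * 'd g (f x) (delta_mx 0 i)).
  apply: Cr_sum => // i _; apply: Cr_mul => //.
    exact: (Cr_coord _ oA (dfr v)).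
  exact: (IH _ _ AB lf (dgr _)).
apply: Cr_eq H => //= x Ax.
rewrite (_ : (fun x => g (f x)) = g \o f) //.
by rewrite (diff_comp (df x Ax) (dg _ (AB x Ax))) /= [RHS]diff_rVE.
Qed.

Lemma Cr_prod V r (A : set V) I (s : seq I) (P : pred I) (f : I -> V -> R) :
  open A -> (forall i, P i -> Cr r A (f i)) ->
  Cr r A (fun x => \prod_(i <- s | P i) f i x).
Proof.
move=> oA cf; elim: s => [|i s IH].
  by apply: Cr_ext (Cr_cst r A (1:R)) => x; rewrite big_nil.
have [Pi|nPi] := boolP (P i); last first.
  by apply: Cr_ext IH => x; rewrite big_cons (negPf nPi).
apply: Cr_ext (Cr_mul oA (cf i Pi) IH) => x.
by rewrite big_cons Pi.
Qed.

Lemma CrV V r (A : set V) (f : V -> R) : open A ->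
  (forall x, A x -> f x != 0) ->
  Cr r A f -> Cr r A (fun x => (f x)^-1).
Proof.
move=> oA f0; elim: r => [|r IH].
  by move=> cf x Ax; apply: cvgV; [exact: f0|exact: cf].
move=> cf; have [df dfr] := cf.
have lV := IH (Cr_le (leqnSn r) cf).
split=> [x Ax|v]; first by apply: differentiableV; [exact: df|exact: f0].
apply: Cr_eq (CrN oA (Cr_mul oA (Cr_mul oA lV lV) (dfr v))) => //= x Ax.
rewrite diffV //; [|exact: df|exact: f0].
by rewrite /= -mulNr -exprVn expr2.
Qed.

Lemma Cr_det V r (A : set V) m (M : V -> 'M[R]_m) : open A ->
  (forall i j, Cr r A (fun x => M x i j)) -> Cr r A (fun x => \det (M x)).
Proof.
move=> oA cM; rewrite /determinant.
apply: Cr_sum => // s _; apply: Cr_mul => //; first exact: Cr_cst.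
by apply: Cr_prod.
Qed.

(** Cofactors are polynomials in the entries. Together with [Cr_det] and [CrV], Cramer's rule then
    yields the regularity of inverse matrices. *)
Lemma Cr_adj V r (A : set V) m (M : V -> 'M[R]_m) i j : open A ->
  (forall i j, Cr r A (fun x => M x i j)) ->
  Cr r A (fun x => \adj (M x) i j).
Proof.
move=> oA cM.
apply: (@Cr_ext _ _ _ _ (fun x => (-1) ^+ (j + i) * \det (row' j (col' i (M x))))).
  by move=> x; rewrite mxE.
apply: Cr_mul => //; first exact: Cr_cst.
by apply: Cr_det => // i' j'; apply: Cr_ext (cM _ _) => x; rewrite !mxE.
Qed.

End Cr_theory.

(** * Mean value estimates and symmetry of second derivatives *)

Section MeanValue.
Context {R : realType}.
Implicit Types V W : normedModType R.

(** The norm of a row vector is the largest absolute value of its coordinates; vector estimates are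
    made coordinatewise through this lemma and [rV_norm_ge]. *)
Lemma rV_normP m (x : 'rV[R]_m) (K : R) : 0 <= K ->
  (forall i, `|x 0 i| <= K) -> `|x| <= K.
Proof.
move=> K0 xK; rewrite [leLHS]/Num.Def.normr/= mx_normrE.
by apply: bigmax_le => // -[i j] _ /=; rewrite (ord1 i).
Qed.

Lemma rV_norm_ge m (x : 'rV[R]_m) i : `|x 0 i| <= `|x|.
Proof.
rewrite [leRHS]/Num.Def.normr/= mx_normrE.
exact: (le_bigmax _ (fun ij => `|x ij.1 ij.2|) (0, i)).
Qed.

Lemma is_derive_curve V W (f : V -> W) (y : R -> V) (t : R) y' :
  is_derive t 1 y y' -> differentiable f (y t) ->
  is_derive t 1 (fun s => f (y s)) ('d f (y t) y').
Proof.
move=> [/derivable1_diffP dy <-] df.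
have dfy := differentiable_comp dy df.
apply: DeriveDef; first by apply/derivable1_diffP.
rewrite [LHS]deriveE // (_ : (fun s => _) = f \o y) //.
by rewrite diff_comp //= deriveE.
Qed.

Lemma is_derive_line V W (f : V -> W) (z v : V) (t : R) :
  differentiable f (z + t *: v) ->
  is_derive t (1:R) (fun s => f (z + s *: v)) ('d f (z + t *: v) v).
Proof.
move=> df.
have H : is_derive t (1:R) (fun s : R => z + s *: v) v.
  have dl : differentiable (fun s : R => s *: v) t by exact: differentiableZl.
  have dd : differentiable (fun s : R => z + s *: v) t.
    by apply: differentiableD => //; exact: differentiable_cst.
  apply: DeriveDef; first by apply/derivable1_diffP.
  rewrite deriveE // diffD //=.
  have [_ E] := is_diff_scalel t v.
  by rewrite diff_cst E add0r scale1r.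
exact: is_derive_curve H df.
Qed.

Lemma MVT_itv (f df : R -> R) (a b : R) : a <= b ->
  (forall t, a <= t <= b -> is_derive t 1 f (df t)) ->
  exists2 c, a <= c <= b & f b - f a = df c * (b - a).
Proof.
rewrite le_eqVlt => /predU1P[<- _|ab fdf].
  by exists a; rewrite ?lexx// !subrr mulr0.
have [] := @MVT _ f df a b ab.
- by move=> x; rewrite in_itv /= => /andP[ax xb]; apply: fdf; rewrite !ltW.
- apply: derivable_within_continuous => x; rewrite in_itv /= => axb.
  by case: (fdf x axb).
by move=> c; rewrite in_itv /= => /andP[ac cb] ->; exists c => //; rewrite !ltW.
Qed.

(** Both orders of [a] and [b] are allowed, for the sake of negative times in the Picard
    iteration. *)
Lemma MVT_dist (f df : R -> R) (K a b : R) :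
  (forall t, Num.min a b <= t <= Num.max a b ->
     is_derive t 1 f (df t) /\ `|df t| <= K) ->
  `|f b - f a| <= K * `|b - a|.
Proof.
wlog ab : a b / a <= b => [H fdf|].
  have [/H|/ltW/H] := leP a b; first exact.
  by rewrite distrC (distrC a) minC maxC; exact.
rewrite (min_idPl ab) (max_idPr ab) => fdf.
have [c cab ->] : exists2 c, a <= c <= b & f b - f a = df c * (b - a).
  by apply: MVT_itv => // t /fdf[].
by rewrite normrM ler_wpM2r //; case: (fdf c cab).
Qed.

Lemma cvg_bound V (f : V -> R) x : {for x, continuous f} ->
  \forall z \near x, `|f z| <= `|f x| + 1.
Proof.
move=> cf; have /cvgrPdist_le /(_ 1 ltr01) := cf.
apply: filterS => z; rewrite distrC => H.
by rewrite -lerBlDl (le_trans _ H) // lerB_dist.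
Qed.

Lemma Cr1_diff_bound m (A : set 'rV[R]_m) (f : 'rV[R]_m -> R) x :
  A x -> Cr 1 A f ->
  exists2 K, 0 <= K & \forall z \near x, forall v, `|'d f z v| <= K * `|v|.
Proof.
move=> Ax [_ /= cdf].
exists (\sum_i (`|'d f x (delta_mx 0 i)| + 1)).
  by apply: sumr_ge0 => i _; rewrite addr_ge0.
have : \forall z \near x, forall i, `|'d f z (delta_mx 0 i)| <= `|'d f x (delta_mx 0 i)| + 1.
  apply: (@filter_forall _ _ (fun i z => `|'d f z (delta_mx 0 i)| <= `|'d f x (delta_mx 0 i)| + 1) (nbhs x) _) => i.
  apply: (@cvg_bound _ (fun z => 'd f z (delta_mx 0 i))).
  exact: cdf.
apply: filterS => z H v.
rewrite mulr_suml.
have E := diff_rVE f z v.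
rewrite [X in `|X|]E.
apply: le_trans (ler_norm_sum _ _ _) _.
apply: ler_sum => i _; rewrite normrZ mulrC.
by apply: ler_pM => //; exact: rV_norm_ge.
Qed.

(** Mean value theorem along the segment from [y] to [x]. Halving the radius puts the closed ball,
    and by convexity the segment, inside the open ball where the differential is bounded. *)
Lemma Cr1_lipschitz m (A : set 'rV[R]_m) (f : 'rV[R]_m -> R) x0 :
  open A -> A x0 -> Cr 1 A f ->
  exists2 K, 0 <= K & exists2 r, 0 < r & forall x y,
    `|x - x0| <= r -> `|y - x0| <= r -> `|f x - f y| <= K * `|x - y|.
Proof.
move=> oA Ax cf; have [K K0 nK] := Cr1_diff_bound Ax cf.
exists K => //.
have : \forall z \near x0, A z /\ forall v, `|'d f z v| <= K * `|v|.
  by near=> z; split; near: z => //; exact: open_nbhs_nbhs.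
move=> /nbhs_ballP[r /= r0 H].
exists (r / 2); first by rewrite divr_gt0.
move=> x y xr yr.
have B t : 0 <= t <= 1 -> ball x0 r (y + t *: (x - y)).
  move=> /andP[t0 t1]; rewrite -ball_normE /= distrC.
  rewrite (_ : _ - _ = t *: (x - x0) + (1 - t) *: (y - x0)); last first.
    rewrite !scalerBr !scalerBl !scale1r opprB.
    rewrite addrACA -!addrA; congr (_).
    by rewrite (addrC y) !addrA; apply/rowP => i; rewrite !mxE; ring.
  rewrite (le_lt_trans (ler_normD _ _)) // !normrZ !ger0_norm ?subr_ge0 //.
  have : t * `|x - x0| + (1 - t) * `|y - x0| <= t * (r/2) + (1 - t) * (r / 2).
    by apply: lerD; apply: ler_wpM2l => //; rewrite subr_ge0.
  by move=> /le_lt_trans; apply; rewrite -mulrDl addrC subrK mul1r; lra.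
have M : `|f (y + 1 *: (x - y)) - f (y + 0 *: (x - y))| <= K * `|x - y| * `|1 - 0|.
  apply: (@MVT_dist (fun t => f (y + t *: (x - y)))
    (fun t => 'd f (y + t *: (x - y)) (x - y))) => t.
  rewrite (min_idPl ler01) (max_idPr ler01) => /B/H[Az bz]; split => //.
  by apply: is_derive_line; case: cf => df _; exact: df.
move: M; rewrite scale1r scale0r addr0 subr0 normr1 mulr1.
by have -> : y + (x - y) = x by rewrite addrC subrK.
Unshelve. all: by end_near. Qed.

(** The mean value theorem is applied twice: to [t |-> f (x + s *: w + t *: v) - f (x + t *: v)],
    then to the derivative along [v] on a segment of direction [w] through the intermediate
    point. *)
Lemma second_difference V (A : set V) (f : V -> R) x (v w : V) s : 0 <= s ->
  Cr 2 A f ->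
  (forall a b, 0 <= a <= s -> 0 <= b <= s -> A (x + a *: v + b *: w)) ->
  exists a b, [/\ 0 <= a <= s, 0 <= b <= s &
    f (x + s *: v + s *: w) - f (x + s *: v) - (f (x + s *: w) - f x) =
    'd (fun y => 'd f y v) (x + a *: v + b *: w) w * s ^+ 2].
Proof.
move=> s0 [df /= ddf] HA.
have ss : 0 <= s <= s by rewrite s0 lexx.
have zs : 0 <= (0:R) <= s by rewrite lexx s0.
have HA0 a : 0 <= a <= s -> A (x + a *: v).
  by move=> /HA /(_ zs); rewrite scale0r addr0.
have D1 t : 0 <= t <= s ->
    is_derive t (1:R) (fun t => f (x + s *: w + t *: v) - f (x + t *: v))
      ('d f (x + s *: w + t *: v) v - 'd f (x + t *: v) v).
  move=> t0; apply: is_deriveB; apply: is_derive_line; apply: df.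
    by rewrite addrAC; exact: HA.
  exact: HA0.
have [a a0 E] := MVT_itv s0 D1.
have D2 t : 0 <= t <= s ->
    is_derive t (1:R) (fun t => 'd f (x + a *: v + t *: w) v)
      ('d (fun y => 'd f y v) (x + a *: v + t *: w) w).
  move=> t0; apply: (@is_derive_line _ _ (fun y => 'd f y v)).
  by case: (ddf v) => + _; apply; exact: HA.
have [b b0 E'] := MVT_itv s0 D2.
exists a, b; split => //.
move: E E'; rewrite !scale0r !addr0 subr0 => E E'.
by rewrite expr2 mulrA -E' [x + a *: v + _]addrAC -E [x + s *: w + _]addrAC.
Qed.

(** The second difference is symmetric in [v] and [w], so the two mixed derivatives agree at two
    possibly distinct points of a small parallelogram; continuity brings both points back to [x]. *)
Lemma schwarz_scalar V (A : set V) (f : V -> R) x (v w : V) :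
  open A -> A x -> Cr 2 A f ->
  'd (fun y => 'd f y v) x w = 'd (fun y => 'd f y w) x v.
Proof.
move=> oA Ax cf; apply/eqP; rewrite -subr_eq0 -normr_le0.
apply/ler_addgt0Pl => e e0; rewrite addr0.
have [_ /= ddf] := cf.
have cvw : {for x, continuous (fun z => 'd (fun y => 'd f y v) z w)}.
  by case: (ddf v) => _ /(_ w); exact.
have cwv : {for x, continuous (fun z => 'd (fun y => 'd f y w) z v)}.
  by case: (ddf w) => _ /(_ v); exact.
have e2 : 0 < e / 2 by rewrite divr_gt0.
have : \forall z \near x, [/\ A z,
    `|'d (fun y => 'd f y v) x w - 'd (fun y => 'd f y v) z w| <= e / 2 &
    `|'d (fun y => 'd f y w) x v - 'd (fun y => 'd f y w) z v| <= e / 2].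
  near=> z; split; near: z; first exact: open_nbhs_nbhs.
    by move: cvw => /cvgrPdist_le; exact.
  by move: cwv => /cvgrPdist_le; exact.
move=> /nbhs_ballP[r /= r0 H].
pose d := `|v| + `|w| + 1.
have d0 : 0 < d by rewrite /d ltr_wpDl // addr_ge0.
(* This size keeps the parallelogram spanned by [s *: v] and [s *: w] in the ball of radius [r]; the
   1 in [d] covers [v = w = 0]. *)
pose s := r / 2 / d.
have s0 : 0 < s by rewrite !divr_gt0.
have B a b : 0 <= a <= s -> 0 <= b <= s -> ball x r (x + a *: v + b *: w).
  move=> /andP[a0 a1] /andP[b0 b1]; rewrite -ball_normE /= -addrA opprD addNKr normrN.
  rewrite (le_lt_trans (ler_normD _ _)) // !normrZ !ger0_norm //.
  have : a * `|v| + b * `|w| <= s * `|v| + s * `|w| by apply: lerD; apply: ler_wpM2r.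
  move=> /le_lt_trans; apply; rewrite -mulrDr.
  have : s * (`|v| + `|w|) <= s * d by rewrite ler_pM2l // /d lerDl.
  by move=> /le_lt_trans; apply; rewrite /s divfK ?gt_eqF//; lra.
have [a1 [b1 [a10 b10 E1]]] := @second_difference _ A f x v w s (ltW s0) cf
  (fun a b ha hb => let: And3 Az _ _ := H _ (B a b ha hb) in Az).
have B' a b : 0 <= a <= s -> 0 <= b <= s -> ball x r (x + a *: w + b *: v).
  by move=> ha hb; rewrite addrAC; exact: B.
have [a2 [b2 [a20 b20 E2]]] := @second_difference _ A f x w v s (ltW s0) cf
  (fun a b ha hb => let: And3 Az _ _ := H _ (B' a b ha hb) in Az).
have : 'd (fun y => 'd f y v) (x + a1 *: v + b1 *: w) w =
       'd (fun y => 'd f y w) (x + a2 *: w + b2 *: v) v.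
  have s2 : s ^+ 2 != 0 by rewrite expf_neq0 // gt_eqF.
  apply: (mulIf s2); rewrite -E1 -E2 [x + s *: w + s *: v]addrAC; ring.
have [_ H1 _] := H _ (B _ _ a10 b10).
have [_ _ H2] := H _ (B' _ _ a20 b20).
move=> E; rewrite (splitr e).
rewrite E in H1; rewrite distrC in H2.
rewrite (_ : _ - _ = ('d (fun y => 'd f y v) x w -
    'd (fun y => 'd f y w) (x + a2 *: w + b2 *: v) v) +
    ('d (fun y => 'd f y w) (x + a2 *: w + b2 *: v) v -
     'd (fun y => 'd f y w) x v)); last by ring.
by rewrite (le_trans (ler_normD _ _)) // lerD.
Unshelve. all: by end_near. Qed.

Lemma schwarz V (A : set V) m (f : V -> 'rV[R]_m) x (v w : V) :
  open A -> A x -> Cr 2 A f ->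
  'd (fun y => 'd f y v) x w = 'd (fun y => 'd f y w) x v.
Proof.
move=> oA Ax cf; have [df /= ddf] := cf; apply/rowP => i.
have E u y : A y -> 'd f y u 0 i = 'd (fun z => f z 0 i) y u.
  by move=> Ay; case: (is_diff_coord i (df y Ay)) => _ ->.
have E2 u1 u2 : 'd (fun y => 'd f y u1) x u2 0 i =
    'd (fun y => 'd (fun z => f z 0 i) y u1) x u2.
  have du : differentiable (fun y => 'd f y u1) x by case: (ddf u1) => + _; exact.
  case: (is_diff_coord i du) => du' du'E.
  rewrite -[LHS]/((fun v => 'd (fun y => 'd f y u1) x v 0 i) u2) -du'E.
  have E3 : {near x, (fun y => 'd f y u1 0 i) =1 (fun y => 'd (fun z => f z 0 i) y u1)}.
    by near=> z; apply: E; near: z; exact: open_nbhs_nbhs.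
  have [_ E4] := near_eq_is_diff E3 du'.
  exact: esym (congr1 (fun F => F u2) E4).
rewrite !E2; exact: (schwarz_scalar v w oA Ax (Cr_coord i oA cf)).
Unshelve. all: by end_near. Qed.

End MeanValue.

(** * The Picard-Lindelof theorem *)

Section Picard.
Context {R : realType}.

(** For [a <= b], the nonexpansive retraction of the line onto [[a, b]]. Applied to time it makes
    the Picard iterates continuous on the whole line; applied to each coordinate it makes a locally
    Lipschitz field globally Lipschitz. *)
Definition clamp (a b x : R) : R := Num.min b (Num.max a x).

Lemma clamp_itv a b x : a <= b -> a <= clamp a b x <= b.
Proof. by move=> ab; rewrite /clamp ge_min lexx le_min ab le_max lexx. Qed.

Lemma clamp_id a b x : a <= x <= b -> clamp a b x = x.
Proof. by move=> /andP[ax xb]; rewrite /clamp (max_idPr ax) (min_idPr xb). Qed.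

Lemma clamp_dist a b x y : `|clamp a b x - clamp a b y| <= `|x - y|.
Proof.
have maxd u v : `|Num.max a u - Num.max a v| <= `|u - v|.
  have h1 := ler_norm (u - v).
  have h2 := ler_norm (v - u); rewrite distrC in h2.
  rewrite ler_norml; case: (leP a u) => au; case: (leP a v) => av;
    apply/andP; split; lra.
have mind u v : `|Num.min b u - Num.min b v| <= `|u - v|.
  have h1 := ler_norm (u - v).
  have h2 := ler_norm (v - u); rewrite distrC in h2.
  rewrite ler_norml; case: (leP b u) => bu; case: (leP b v) => bv;
    apply/andP; split; lra.
exact: le_trans (mind _ _) (maxd _ _).
Qed.

Lemma clamp_continuous a b : continuous (clamp a b).
Proof.
move=> x; apply/cvgrPdist_lt => e e0.
have /cvgrPdist_lt /(_ e e0) := @cvg_id _ (nbhs x).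
by apply: filterS => y; exact: le_lt_trans (clamp_dist _ _ _ _).
Qed.

Lemma primitive_exists (T : R) (phi : R -> R) : continuous phi ->
  exists Phi : R -> R, Phi 0 = 0 /\
    forall t, `|t| <= T -> is_derive t (1:R) Phi (phi t).
Proof.
(* The integral starts strictly to the left of [- T], so that each [t] with [|t| <= T] is interior
   to the interval on which the fundamental theorem of calculus is applied. *)
move=> cphi; pose a := - (T + 1).
pose F0 := fun x : R => (\int[lebesgue_measure]_(t in `[a, x]) phi t)%R.
exists (fun x => F0 x - F0 0); split; first by rewrite subrr.
move=> t tT; have [ta tb] : a < t /\ t < T + 1.
  by move: tT; rewrite ler_norml /a => /andP[? ?]; split; lra.
have intphi : lebesgue_measure.-integrable `[a, T + 1] (EFin \o phi).
  apply: continuous_compact_integrable; first exact: segment_compact.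
  exact: continuous_subspaceT.
have [dF FE] := @continuous_FTC1 R phi (BLeft a) t (T + 1) tb intphi ta (cphi t).
have H : is_derive t (1:R) F0 (phi t).
  by apply: DeriveDef; [exact: dF|exact: (etrans (esym (derive1E _ _)) FE)].
have Hc : is_derive t (1:R) (fun=> F0 0) 0 by exact: is_derive_cst.
by have := is_deriveB H Hc; rewrite subr0.
Qed.

(** The rate is kept in the conclusion because it makes the pointwise limit of the Picard iterates a
    uniform one. *)
Lemma geometric_limit (a : nat -> R) (C : R) :
  (forall j k, `|a (j + k)%N - a j| <= C * 2^-1 ^+ j) ->
  exists l, forall j, `|l - a j| <= C * 2^-1 ^+ j.
Proof.
move=> aC.
have g0 : (fun j => C * 2^-1 ^+ j) @ \oo --> (0:R).
  rewrite -[X in _ --> X](mulr0 C); apply: cvgMl_tmp.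
  by apply: cvg_expr; rewrite ger0_norm // invf_lt1 // ltr1n.
have ca : cvgn a.
  apply/cauchy_cvgP/cauchy_ballP => e e0.
  have : \forall j \near \oo, C * 2^-1 ^+ j < e / 2.
    have /cvgrPdist_lt /(_ (e / 2)) := g0.
    rewrite divr_gt0 // => /(_ isT); apply: filterS => j.
    by rewrite sub0r normrN => /(le_lt_trans (ler_norm _)).
  move=> [N _ HN].
  exists ([set a j | j in [set j | (N <= j)%N]], [set a j | j in [set j | (N <= j)%N]]).
    by split; exists N => // j /= Nj; exists j.
  move=> [_ _] /= [[i Ni <-] [j Nj <-]].
  rewrite -ball_normE /=.
  have := aC N (i - N)%N; have := aC N (j - N)%N; rewrite !subnKC //.
  have := HN N (leqnn N) => /= H1 H2 H3.
  rewrite (_ : a i - a j = (a i - a N) - (a j - a N)); last by ring.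
  by rewrite (le_lt_trans (ler_normB _ _)) //; lra.
exists (lim (a @ \oo)) => j.
apply: (@closed_cvg _ _ \oo _ a (fun x => `|x - a j| <= C * 2^-1 ^+ j)) ca.
  rewrite (_ : (fun x => _) = closed_ball_ Num.norm (a j) (C * 2^-1 ^+ j)); last first.
    by apply/funext => x /=; rewrite distrC.
  exact: closed_closed_ball_.
near=> i; have ji : (j <= i)%N by near: i; exists j.
by have := aC j (i - j)%N; rewrite subnKC.
Unshelve. all: by end_near. Qed.

Lemma le_geometric0 (x C : R) : (forall j, x <= C * 2^-1 ^+ j) -> x <= 0.
Proof.
move=> H; have g0 : (fun j => C * 2^-1 ^+ j) @ \oo --> (0:R).
  rewrite -[X in _ --> X](mulr0 C); apply: cvgMl_tmp.
  by apply: cvg_expr; rewrite ger0_norm // invf_lt1 // ltr1n.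
have <- := cvg_lim (@Rhausdorff R) g0.
apply: limr_ge; first by apply/cvg_ex; exists 0.
by near=> j; exact: H.
Unshelve. all: by end_near. Qed.

(* [K * T <= 2^-1] makes the Picard operator a contraction of ratio 1/2. *)
Lemma picard_lipschitz m (f : 'rV[R]_m -> 'rV[R]_m) (z0 : 'rV[R]_m) (K T : R) :
  0 <= K -> 0 < T -> K * T <= 2^-1 ->
  (forall x y, `|f x - f y| <= K * `|x - y|) ->
  exists u : R -> 'rV[R]_m, u 0 = z0 /\
    forall t, `|t| < T -> is_derive t (1:R) u (f (u t)).
Proof.
move=> K0 T0 KT fK.
have cf : continuous f.
  move=> x; apply/(@cvgrPdist_lt _ _ _ (nbhs x)) => e e0.
  have K1 : 0 < K + 1 by rewrite ltr_wpDl.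
  have /(@cvgrPdist_lt _ _ _ (nbhs x)) /(_ _ (divr_gt0 e0 K1)) := @cvg_id _ (nbhs x).
  apply: filterS => y; rewrite ltr_pdivlMr // => h.
  rewrite (le_lt_trans (fK _ _)) // (le_lt_trans _ h) // mulrC ler_wpM2l //; lra.
have [P HP] : exists P : (R -> R) -> (R -> R), forall phi, continuous phi ->
    P phi 0 = 0 /\ forall t, `|t| <= T -> is_derive t (1:R) (P phi) (phi t).
  pose Q phi Phi := continuous phi -> Phi 0 = 0 /\
    forall t, `|t| <= T -> is_derive t (1:R) (Phi : R -> R) ((phi : R -> R) t).
  have /choice[P HP] : forall phi, exists Phi, Q phi Phi.
    (* Choice asks for a value at every [phi]; when [phi] is not continuous the requirement is
       vacuous and [phi] is a dummy. *)
    move=> phi; have [c|nc] := pselect (continuous phi); last by exists phi.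
    by have [Phi HPhi] := primitive_exists T c; exists Phi.
  by exists P.
have TT : - T <= T by lra.
pose rhs (u : R -> 'rV[R]_m) i : R -> R := fun s => f (u s) 0 i.
(* The Picard operator: the initial value plus the integral of [f] along [u], with time clamped to
   [[- T, T]]. *)
pose step (u : R -> 'rV[R]_m) (t : R) : 'rV[R]_m := z0 + \row_i P (rhs u i) (clamp (- T) T t).
have crhs u i : continuous u -> continuous (rhs u i).
  move=> cu s; apply: (@continuous_comp _ _ _ (fun s => f (u s)) (fun z : 'rV_m => z 0 i)).
    by apply: (@continuous_comp _ _ _ u f); [exact: cu|exact: cf].
  exact: coord_continuous.
have clT t : `|clamp (- T) T t| <= T by rewrite ler_norml clamp_itv.
have betw (s t : R) : `|t| <= T -> Num.min 0 t <= s <= Num.max 0 t -> `|s| <= T.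
  rewrite !ler_norml => /andP[t1 t2]; rewrite minEle maxEle.
  by case: ifP => _ /andP[? ?]; apply/andP; split; lra.
have normT (t : R) : `|t| <= T -> forall D, 0 <= D -> D * `|t| <= D * T.
  by move=> tT D D0; rewrite ler_wpM2l.
have stepc u : continuous u -> continuous (step u).
  move=> cu t; rewrite /step; apply: cvgD; first exact: cvg_cst.
  apply: (@continuous_comp _ _ _ (clamp (-T) T) (fun s => \row_i P (rhs u i) s)).
    exact: clamp_continuous.
  apply: differentiable_continuous; apply: differentiable_rVP => i.
  rewrite (_ : (fun y => _) = P (rhs u i)); last by apply/funext => y; rewrite mxE.
  by apply/derivable1_diffP; case: (HP _ (crhs u i cu)) => _ /(_ _ (clT t))[].
(* Integrating a difference of size [K * D] over a time at most [T] gives at most [K * T * D], hence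
   at most [D / 2]. *)
have contr u v D : continuous u -> continuous v -> 0 <= D ->
    (forall t, `|u t - v t| <= D) -> forall t, `|step u t - step v t| <= D / 2.
  move=> cu cv D0 uv t; apply: rV_normP => [|i]; first by rewrite divr_ge0.
  rewrite !mxE opprD addrACA subrr add0r.
  have [Pu0 Pu] := HP _ (crhs u i cu); have [Pv0 Pv] := HP _ (crhs v i cv).
  set s := clamp _ _ _.
  have : `|(P (rhs u i) s - P (rhs v i) s) - (P (rhs u i) 0 - P (rhs v i) 0)| <=
      K * D * `|s - 0|.
    apply: (@MVT_dist _ (fun s => P (rhs u i) s - P (rhs v i) s)
      (fun s => rhs u i s - rhs v i s)) => w /betw wT.
    have wT' := wT (clT t); split; first by apply: is_deriveB; [exact: Pu|exact: Pv].
    rewrite /rhs (_ : _ - _ = (f (u w) - f (v w)) 0 i); last by rewrite !mxE.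
    by rewrite (le_trans (rV_norm_ge _ _)) // (le_trans (fK _ _)) // ler_wpM2l.
  rewrite Pu0 Pv0 !subr0 => /le_trans; apply.
  rewrite (le_trans (normT _ (clT t) _ _)) ?mulr_ge0 // mulrAC mulrC ler_wpM2l //.
pose u_ (j : nat) : R -> 'rV[R]_m := iter j step (fun=> z0).
have cu_ j : continuous (u_ j).
  by elim: j => [|j IH]; [move=> t; exact: cvg_cst|exact: stepc].
pose C := `|f z0| * T.
have C0 : 0 <= C by rewrite mulr_ge0 // ltW.
have gj j : 0 <= 2 * C * 2^-1 ^+ j.
  by apply: mulr_ge0; [exact: mulr_ge0|exact: exprn_ge0].
have du j : forall t, `|u_ j.+1 t - u_ j t| <= C * 2^-1 ^+ j.
  elim: j => [|j IH] t.
    rewrite expr0 mulr1 /= /step addrC addKr; apply: rV_normP => // i.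
    rewrite mxE; have [P0 Pd] := HP _ (crhs _ i (cu_ 0%N)).
    rewrite -[X in `|X|]subr0 -[X in _ - X]P0.
    have := @MVT_dist _ (P (rhs (u_ 0%N) i)) (rhs (u_ 0%N) i) `|f z0| 0 (clamp (-T) T t).
    rewrite subr0 => /(_ _)/le_trans; apply; last exact: normT.
    by move=> w /betw wT; split; [exact/Pd/wT|exact: rV_norm_ge].
  rewrite exprSr mulrA; apply: (contr (u_ j.+1) (u_ j)); [exact: cu_|exact: cu_| |exact: IH].
  by rewrite mulr_ge0 // exprn_ge0.
(* The right-hand side is the exact partial sum of the geometric series from [j] to [j + k - 1], a
   form in which the induction on [k] closes. *)
have dujk t j k : `|u_ (j + k)%N t - u_ j t| <=
    C * (2 * 2^-1 ^+ j - 2 * 2^-1 ^+ (j + k)).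
  elim: k => [|k IH]; first by rewrite addn0 !subrr normr0 mulr0.
  rewrite addnS -(subrK (u_ (j + k)%N t) (u_ _ t)) -addrA.
  rewrite (le_trans (ler_normD _ _)) // (le_trans (lerD (du _ _) IH)) //.
  by rewrite exprSr -mulrDr ler_wpM2l //; lra.
have dujk2 t j k : `|u_ (j + k)%N t - u_ j t| <= 2 * C * 2^-1 ^+ j.
  rewrite (le_trans (dujk _ _ _)) // -[2 * C * _]mulrA -[leRHS]mulrCA ler_wpM2l //.
  rewrite lerBlDr lerDl.
  by rewrite mulr_ge0 // exprn_ge0.
have [u Hu] : exists u : R -> 'rV[R]_m, forall t j, `|u t - u_ j t| <= 2 * C * 2^-1 ^+ j.
  have lims t i : exists l, forall j, `|l - u_ j t 0 i| <= 2 * C * 2^-1 ^+ j.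
    apply: (@geometric_limit (fun j => u_ j t 0 i)) => j k.
    rewrite (_ : _ - _ = (u_ (j + k)%N t - u_ j t) 0 i); last by rewrite !mxE.
    by rewrite (le_trans (rV_norm_ge _ _)).
  have /choice[l Hl] : forall ti, exists l, forall j,
      `|l - u_ j ti.1 0 ti.2| <= 2 * C * 2^-1 ^+ j by move=> [t i]; exact: lims.
  exists (fun t => \row_i l (t, i)) => t j.
  apply: rV_normP => [|i]; first exact: gj.
  by rewrite !mxE; exact: (Hl (t, i)).
have cu : continuous u.
  move=> t; apply/cvgrPdist_lt => e e0.
  have [j Hj] : exists j, 2 * C * 2^-1 ^+ j < e / 3.
    apply: contrapT => /forallNP H.
    have : e / 3 <= 0.
      by apply: (@le_geometric0 _ (2 * C)) => j; rewrite leNgt; apply/negP/H.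
    by apply/negP; rewrite -ltNge divr_gt0.
  near=> s.
  rewrite (_ : u t - u s = (u t - u_ j t) - (u s - u_ j s) + (u_ j t - u_ j s)); last first.
    by apply/rowP => i; rewrite !mxE; ring.
  have h1 := Hu t j; have h2 := Hu s j.
  have h3 : `|u_ j t - u_ j s| < e / 3.
    by near: s; have /cvgrPdist_lt := cu_ j t; apply; rewrite divr_gt0.
  rewrite (le_lt_trans (ler_normD _ _)) // (le_lt_trans (lerD (ler_normB _ _) (lexx _))) //.
  lra.
(* Both [step u] and [u] are within a geometrically small distance of [u_ j.+1], the former by
   contraction, so they coincide. *)
have fixu t : step u t = u t.
  apply/eqP; rewrite -subr_eq0 -normr_le0.
  apply: (@le_geometric0 _ (4 * C)) => j.
  have h1 : `|step u t - u_ j.+1 t| <= 2 * C * 2^-1 ^+ j / 2.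
    apply: (contr u (u_ j)); [exact: cu|exact: cu_| |by move=> s; exact: Hu].
    exact: gj.
  have h2 := Hu t j.+1; rewrite exprSr in h2.
  have h3 : 0 <= C * 2^-1 ^+ j by rewrite mulr_ge0 // exprn_ge0.
  rewrite -(subrK (u_ j.+1 t) (step u t)) -addrA (le_trans (ler_normD _ _)) //.
  rewrite distrC in h2.
  rewrite (le_trans (lerD h1 h2)) //; lra.
exists u; split.
  rewrite -fixu /step clamp_id ?TT; last by apply/andP; split; lra.
  apply/rowP => i; rewrite !mxE.
  by have [-> _] := HP _ (crhs u i cu); rewrite addr0.
move=> t tT.
have H i : is_derive t (1:R) (fun s => z0 0 i + P (rhs u i) s) (rhs u i t).
  have [_ /(_ t (ltW tT)) H] := HP _ (crhs u i cu).
  have Hc : is_derive t (1:R) (fun=> z0 0 i) 0 by exact: is_derive_cst.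
  by have := is_deriveD Hc H; rewrite add0r.
(* Strictly inside the interval the clamp is the identity near [t], so the fixed-point equation is
   there the integral equation. *)
have nE i : \forall s \near t, z0 0 i + P (rhs u i) s = u s 0 i.
  have : \forall s \near t, `|s| < T.
    have : {for t, continuous (fun s : R => `|s|)} by exact: norm_continuous.
    by move=> /(_ [set x | x < T]); apply; apply: lt_nbhsl.
  apply: filterS => s sT; rewrite -fixu /step !mxE clamp_id //.
  by move: (ltW sT); rewrite ler_norml.
have Hu1 i : is_derive t (1:R) (fun s => u s 0 i) (f (u t) 0 i).
  exact: near_eq_is_derive (nE i) (H i).
have du1 : derivable u t (1:R).
  by apply/derivable_mxP => i j; rewrite (ord1 i); case: (Hu1 j).
apply: DeriveDef => //.
rewrite derive_mx //; apply/rowP => i; rewrite mxE.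
by case: (Hu1 i).
Unshelve. all: by end_near. Qed.

(** The field is precomposed with the coordinatewise truncation [pr] onto a closed ball around [z0],
    which makes it globally Lipschitz. For a short time the solution stays in that ball, where [pr]
    is the identity, and so solves the original equation. *)
Lemma picard m (A : set 'rV[R]_m) (f : 'rV[R]_m -> 'rV[R]_m) (z0 : 'rV[R]_m) :
  open A -> A z0 -> (forall i, Cr 1 A (fun z => f z 0 i)) ->
  exists T, 0 < T /\ exists u : R -> 'rV[R]_m, u 0 = z0 /\
    forall t, `|t| < T -> A (u t) /\ is_derive t (1:R) u (f (u t)).
Proof.
move=> oA Az0 cf.
have /choice[Kr HKr] : forall i, exists Kr : R * R, [/\ 0 <= Kr.1, 0 < Kr.2 & forall x y,
    `|x - z0| <= Kr.2 -> `|y - z0| <= Kr.2 -> `|f x 0 i - f y 0 i| <= Kr.1 * `|x - y|].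
  by move=> i; have [K K0 [r r0 H]] := Cr1_lipschitz oA Az0 (cf i); exists (K, r).
have [rA rA0 HA] : exists2 r, 0 < r & forall x, `|x - z0| <= r -> A x.
  have : nbhs z0 A by exact: open_nbhs_nbhs.
  move=> /nbhs_ballP[r /= r0 H]; exists (r / 2); first by rewrite divr_gt0.
  move=> x xr; apply: H; rewrite -ball_normE /= distrC (le_lt_trans xr) //; lra.
pose r := \big[Num.min/rA]_i (Kr i).2.
have r0 : 0 < r.
  by rewrite /r; elim/big_ind: _ => // [x y x0 y0|i _]; [rewrite lt_min x0|case: (HKr i)].
have rle i : r <= (Kr i).2 by exact: bigmin_le_cond.
have rleA : r <= rA by exact: bigmin_le_id.
pose K := \sum_i (Kr i).1.
have K1 i : 0 <= (Kr i).1 by case: (HKr i).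
have K0 : 0 <= K by apply: sumr_ge0.
have Kle i : (Kr i).1 <= K by rewrite /K (bigD1 i) //= lerDl sumr_ge0.
pose pr (x : 'rV[R]_m) : 'rV[R]_m := \row_i clamp (z0 0 i - r) (z0 0 i + r) (x 0 i).
have prr x : `|pr x - z0| <= r.
  apply: rV_normP => [|i]; first exact: ltW.
  rewrite !mxE; have : z0 0 i - r <= z0 0 i + r by lra.
  move=> /(clamp_itv (x 0 i)) /andP[h1 h2].
  by rewrite ler_norml; apply/andP; split; lra.
have prid x : `|x - z0| <= r -> pr x = x.
  move=> xr; apply/rowP => i; rewrite mxE clamp_id //.
  have := le_trans (rV_norm_ge _ i) xr; rewrite !mxE ler_norml => /andP[? ?].
  by apply/andP; split; lra.
have pr1 x y : `|pr x - pr y| <= `|x - y|.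
  apply: rV_normP => // i; rewrite !mxE (le_trans (clamp_dist _ _ _ _)) //.
  by have := rV_norm_ge (x - y) i; rewrite !mxE.
(* The shift by 1 keeps the inverse meaningful when [K = 0] and still gives [K * T <= 2^-1]. *)
pose T := (2 * (K + 1))^-1.
have T0 : 0 < T by rewrite invr_gt0 mulr_gt0 // ltr_wpDl.
have KT : K * T <= 2^-1.
  rewrite /T invfM mulrCA ler_piMr // ler_pdivrMr ?ltr_wpDl //; lra.
have fK x y : `|f (pr x) - f (pr y)| <= K * `|x - y|.
  apply: rV_normP => [|i]; first by rewrite mulr_ge0.
  rewrite !mxE; have [_ _ /(_ (pr x) (pr y))] := HKr i.
  move=> /(_ (le_trans (prr _) (rle i)) (le_trans (prr _) (rle i))) /le_trans; apply.
  by apply: ler_pM.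
have [u [u0 Hu]] := picard_lipschitz z0 K0 T0 KT fK.
have cu0 : {for 0, continuous u}.
  apply: differentiable_continuous; apply/derivable1_diffP.
  by case: (Hu 0) => //; rewrite normr0.
have : \forall t \near (0:R), `|t| < T /\ `|u t - z0| <= r.
  near=> t; split.
    near: t; have /cvgrPdist_lt /(_ T T0) : {for (0:R), continuous (fun x : R => x)} by exact: cvg_id.
    by apply: filterS => t; rewrite sub0r normrN.
  near: t; have /cvgrPdist_le /(_ r r0) := cu0.
  by apply: filterS => t; rewrite u0 distrC.
move=> /nbhs_ballP[T' /= T'0 HT'].
exists T'; split => //; exists u; split => // t tT.
have [tT2 tr] : `|t| < T /\ `|u t - z0| <= r.
  by apply: HT'; rewrite -ball_normE /= sub0r normrN.
split; first by apply: HA; exact: le_trans rleA.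
by have := Hu t tT2; rewrite prid.
Unshelve. all: by end_near. Qed.

End Picard.

(** * Euler-Lagrange equations in coordinates *)

Section DeriveHelpers.
Context {R : realType}.
Implicit Types V W : normedModType R.

Lemma is_derive_mul V (f g : V -> R) x v df dg :
  is_derive x v f df -> is_derive x v g dg ->
  is_derive x v (fun z => f z * g z) (df * g x + f x * dg).
Proof.
move=> hf hg; have := is_deriveM hf hg.
by rewrite addrC [_ *: df]mulrC.
Qed.

Lemma is_derive_bigsum V m (h : 'I_m -> V -> R) x v (dh : 'I_m -> R) :
  (forall i, is_derive x v (h i) (dh i)) ->
  is_derive x v (fun z => \sum_i h i z) (\sum_i dh i).
Proof.
move=> H; have := is_derive_sum H.
by rewrite (_ : \sum_i h i = fun z => \sum_i h i z) //; apply/funext => z; rewrite fct_sumE.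
Qed.

Lemma is_derive_diff V W (f : V -> W) x v :
  differentiable f x -> is_derive x v f ('d f x v).
Proof.
by move=> df; apply: DeriveDef; [exact: diff_derivable|rewrite deriveE].
Qed.

Lemma is_derive_coord m (y : R -> 'rV[R]_m) (t : R) y' i :
  is_derive t (1:R) y y' -> is_derive t (1:R) (fun s => y s 0 i) (y' 0 i).
Proof.
move=> [dy <-]; apply: DeriveDef; first by move/derivable_mxP : dy.
by rewrite derive_mx // mxE.
Qed.

Lemma is_derive_rV m (y : R -> 'rV[R]_m) (t : R) (y' : 'rV[R]_m) :
  (forall i, is_derive t (1:R) (fun s => y s 0 i) (y' 0 i)) ->
  is_derive t (1:R) y y'.
Proof.
move=> H; have dy : derivable y t (1:R).
  by apply/derivable_mxP => i j; rewrite (ord1 i); case: (H j).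
apply: DeriveDef => //; rewrite derive_mx //; apply/rowP => i; rewrite mxE.
by case: (H i).
Qed.

Lemma is_derive_continuous W (f : R -> W) (t : R) df :
  is_derive t (1:R) f df -> {for t, continuous f}.
Proof. by move=> [/derivable1_diffP df' _]; exact: differentiable_continuous. Qed.

Lemma is_derive_pair V W (f : R -> V) (g : R -> W) (t : R) df dg :
  is_derive t (1:R) f df -> is_derive t (1:R) g dg ->
  is_derive t (1:R) (fun s => (f s, g s)) (df, dg).
Proof.
move=> [/derivable1_diffP hf <-] [/derivable1_diffP hg <-].
have h := differentiable_pair hf hg.
apply: DeriveDef; first by apply/derivable1_diffP.
by rewrite deriveE // diff_pair // !deriveE.
Qed.

Lemma diff_fst_snd V W (U : normedModType R) (f : V * W -> U) (x : V) (w : W) a b :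
  differentiable f (x, w) ->
  [/\ differentiable (fun z => f (z, w)) x,
      differentiable (fun z => f (x, z)) w,
      'd f (x, w) (a, 0) = 'd (fun z => f (z, w)) x a,
      'd f (x, w) (0, b) = 'd (fun z => f (x, z)) w b &
      'd f (x, w) (a, b) = 'd (fun z => f (z, w)) x a + 'd (fun z => f (x, z)) w b].
Proof.
move=> df.
have d1 : is_diff x (fun z : V => (z, w)) (fun z => (z, 0)).
  exact: is_diff_pair.
have d2 : is_diff w (fun z : W => (x, z)) (fun z => (0, z)).
  exact: is_diff_pair.
have [e1 E1] := d1; have [e2 E2] := d2.
have F1 : 'd (fun z => f (z, w)) x a = 'd f (x, w) (a, 0).
  rewrite -[fun z => f (z, w)]/(f \o (fun z => (z, w))).
  by rewrite (diff_comp e1 df) /= E1.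
have F2 : 'd (fun z => f (x, z)) w b = 'd f (x, w) (0, b).
  rewrite -[fun z => f (x, z)]/(f \o (fun z => (x, z))).
  by rewrite (diff_comp e2 df) /= E2.
split.
- exact: (differentiable_comp e1 df).
- exact: (differentiable_comp e2 df).
- by [].
- by [].
rewrite F1 F2 -linearD; congr ('d f (x, w) _).
by rewrite -[RHS]/((a + 0, 0 + b)) addr0 add0r.
Qed.

Lemma Cr_fst V W r (A : set (V * W)) : Cr r A (fst : V * W -> V).
Proof.
have pl : linear (fst : V * W -> V) by move=> a u v.
pose pM := GRing.isLinear.Build _ _ _ _ _ pl.
pose pL : {linear (V * W)%type -> V} := HB.pack (fst : V * W -> V) pM.
by apply: (@Cr_lin _ _ _ r A pL) => x; exact: cvg_fst.
Qed.

Lemma Cr_snd V W r (A : set (V * W)) : Cr r A (snd : V * W -> W).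
Proof.
have pl : linear (snd : V * W -> W) by move=> a u v.
pose pM := GRing.isLinear.Build _ _ _ _ _ pl.
pose pL : {linear (V * W)%type -> W} := HB.pack (snd : V * W -> W) pM.
by apply: (@Cr_lin _ _ _ r A pL) => x; exact: cvg_snd.
Qed.

Lemma Cr_diff_comp V r (Om : set V) m (A : set 'rV[R]_m) (f : 'rV[R]_m -> R)
    (h k : V -> 'rV[R]_m) : open Om -> (forall z, Om z -> A (h z)) ->
  Cr r.+1 A f -> Cr r Om h -> Cr r Om k -> Cr r Om (fun z => 'd f (h z) (k z)).
Proof.
move=> oO OA [_ cf] ch ck.
apply: (@Cr_ext _ _ _ _ _ (fun z => \sum_i k z 0 i * 'd f (h z) (delta_mx 0 i))).
  by move=> z; rewrite [LHS]diff_rVE.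
apply: Cr_sum => // i _; apply: Cr_mul => //; first exact: (Cr_coord i oO ck).
exact: (Cr_comp oO OA ch (cf _)).
Qed.

Lemma open_fst V W (A : set V) : open A -> open [set q : (V * W)%type | A q.1].
Proof. by move=> oA; apply: (@open_comp _ _ (fst : V * W -> V)) => // x _; exact: cvg_fst. Qed.

(** The tangent map [(y, w) |-> 'd phi y w] describes how velocities change under a change of
    coordinates. Being linear in [w], it contributes the second derivative of [phi] in the base
    direction and ['d phi y] in the fibre direction. *)
Lemma is_diff_tangent m p (A : set 'rV[R]_m) (phi : 'rV[R]_m -> 'rV[R]_p) y w a b :
  open A -> A y -> Cr 2 A phi ->
  differentiable (fun q : 'rV[R]_m * 'rV[R]_m => 'd phi (q.1) (q.2)) (y, w) /\
  'd (fun q : 'rV[R]_m * 'rV[R]_m => 'd phi (q.1) (q.2)) (y, w) (a, b) =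
  'd (fun z => 'd phi z w) y a + 'd phi y b.
Proof.
move=> oA Ay cphi.
have dphi x : A x -> differentiable phi x by case: cphi => + _; exact.
have dT : differentiable (fun q : 'rV[R]_m * 'rV[R]_m => 'd phi (q.1) (q.2)) (y, w).
  apply: differentiable_rVP => j.
  have oO := @open_fst _ 'rV[R]_m _ oA.
  have H : Cr 1 [set q : 'rV[R]_m * 'rV[R]_m | A q.1]
      (fun q => 'd (fun z => phi z 0 j) (q.1) (q.2)).
    apply: (@Cr_diff_comp _ 1 _ _ A) => //; [exact: Cr_coord|exact: Cr_fst|exact: Cr_snd].
  have [+ _] : Cr 1 [set q : 'rV[R]_m * 'rV[R]_m | A q.1]
      (fun q => 'd phi (q.1) (q.2) 0 j).
    apply: (Cr_eq oO _ H) => q Aq.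
    by have [_ E] := is_diff_coord j (dphi _ Aq); exact: (congr1 (@^~ q.2) E).
  exact.
split; first exact: dT.
have cd : continuous ('d phi y) by exact: diff_continuous (dphi _ Ay).
have E2 : 'd (fun z => 'd phi y z) w b = 'd phi y b.
  exact: (congr1 (@^~ b) (diff_lin w cd)).
have [_ _ _ _ E] := diff_fst_snd a b dT.
exact: (etrans E (congr1 (fun u => 'd (fun z => 'd phi z w) y a + u) E2)).
Qed.

End DeriveHelpers.

Section EulerLagrange.
Context {R : realType} {n : nat}.
Local Notation rV := 'rV[R]_n.
Implicit Types (l : rV -> rV -> R) (y : R -> rV).

Definition uncurried l : rV * rV -> R := fun q => l q.1 q.2.

Definition EL_at l y (t : R) := forall v : rV,
  is_derive t (1:R) (fun s => 'D_v (fun w => l (y s) w) (derive1 y s))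
    ('D_v (fun z => l z (derive1 y t)) (y t)).

Lemma derive_snd l x w v : differentiable (uncurried l) (x, w) ->
  'D_v (fun w => l x w) w = 'd (uncurried l) (x, w) (0, v).
Proof.
by move=> dl; have [_ d2 _ -> _] := diff_fst_snd 0 v dl; rewrite deriveE.
Qed.

Lemma derive_fst l x w v : differentiable (uncurried l) (x, w) ->
  'D_v (fun z => l z w) x = 'd (uncurried l) (x, w) (v, 0).
Proof.
by move=> dl; have [d1 _ -> _ _] := diff_fst_snd v 0 dl; rewrite deriveE.
Qed.

(** In the standard basis this is the product rule combined with the Euler-Lagrange equations. It is
    the single tool behind three facts: with [V] the velocity, conservation of energy; with [V] a
    vector field along the motion, the rate of its momentum; with [V] a constant vector seen through
    a change of coordinates, invariance of the equations. *)
Lemma EL_moving l y (t : R) (V : R -> rV) V' :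
  (\forall s \near t, differentiable (uncurried l) (y s, derive1 y s)) ->
  EL_at l y t -> is_derive t (1:R) V V' ->
  is_derive t (1:R) (fun s => 'd (uncurried l) (y s, derive1 y s) (0, V s))
    ('d (uncurried l) (y t, derive1 y t) (V t, V')).
Proof.
move=> dl el dV.
have dlt := nbhs_singleton dl.
pose e i : rV := delta_mx 0 i.
have dec s (a b : rV) : differentiable (uncurried l) (y s, derive1 y s) ->
    'd (uncurried l) (y s, derive1 y s) (a, b) =
    \sum_i (a 0 i * 'D_(e i) (fun z => l z (derive1 y s)) (y s) +
            b 0 i * 'D_(e i) (fun w => l (y s) w) (derive1 y s)).
  move=> ds; have [d1 d2 _ _ ->] := diff_fst_snd a b ds.
  rewrite big_split /=; congr (_ + _).
    have E := diff_rVE (fun z => uncurried l (z, derive1 y s)) (y s) a.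
    by rewrite [LHS]E; apply: eq_bigr => i _; rewrite deriveE.
  have E := diff_rVE (fun z => uncurried l (y s, z)) (derive1 y s) b.
  by rewrite [LHS]E; apply: eq_bigr => i _; rewrite deriveE.
have H := is_derive_bigsum (fun i => is_derive_mul (is_derive_coord i dV) (el (e i))).
have D := dec t (V t) V' dlt.
apply: (is_derive_eq _ (esym D)).
have nE : \forall s \near t, \sum_i V s 0 i * 'D_(e i) (fun w => l (y s) w) (derive1 y s) =
    'd (uncurried l) (y s, derive1 y s) (0, V s).
  move: dl; apply: filterS => s ds; have E := dec s 0 (V s) ds.
  apply: etrans (esym E); apply: eq_bigr => i _.
  by rewrite [X in X * _ + _]mxE mul0r add0r.
apply: (near_eq_is_derive nE); apply: is_derive_eq H _.
by apply: eq_bigr => i _; exact: addrC.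
Qed.

Lemma is_derive_tangent p (A : set rV) (phi : rV -> 'rV[R]_p) y (t : R)
    (y' : rV) (V : R -> rV) (V' : rV) :
  open A -> A (y t) -> Cr 2 A phi ->
  is_derive t (1:R) y y' -> is_derive t (1:R) V V' ->
  is_derive t (1:R) (fun s => 'd phi (y s) (V s))
    ('d (fun z => 'd phi z (V t)) (y t) y' + 'd phi (y t) V').
Proof.
move=> oA Ay cphi dy dV.
have [dT TE] := is_diff_tangent (V t) y' V' oA Ay cphi.
exact: (is_derive_eq (is_derive_curve (is_derive_pair dy dV) dT) TE).
Qed.

Lemma EL_change l l0 (A B : set rV) (phi psi : rV -> rV) y (t : R) (y2 : rV) :
  open A -> open B -> Cr 2 A phi -> Cr 2 B psi ->
  (forall x, A x -> B (phi x)) ->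
  (forall z, B z -> A (psi z)) ->
  (forall x, A x -> psi (phi x) = x) ->
  (forall z, B z -> phi (psi z) = z) ->
  (forall x w, A x -> l0 x w = l (phi x) ('d phi x w)) ->
  (forall z w, B z -> differentiable (uncurried l) (z, w)) ->
  A (y t) ->
  (\forall s \near t, is_derive s (1:R) y (derive1 y s)) ->
  is_derive t (1:R) (derive1 y) y2 ->
  EL_at l0 y t -> EL_at l (phi \o y) t.
Proof.
move=> oA oB cphi cpsi AB BA psiK phiK l0E dl Ay dy d2y el v.
have dphi x : A x -> differentiable phi x by case: cphi => + _; exact.
have dpsi x : B x -> differentiable psi x by case: cpsi => + _; exact.
have dyt := nbhs_singleton dy.
have nA : \forall s \near t, A (y s).
  by apply: (is_derive_continuous dyt); exact: open_nbhs_nbhs.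
(* The momentum along v in the new chart is the momentum along the moving
   vector V in the old one; differentiating D(phi) V = v and using the symmetry
   of D^2(phi) cancels the second-order terms. *)
pose V s := 'd psi (phi (y s)) v.
have dV : is_derive t (1:R) V ('d (fun z => 'd psi z v) (phi (y t)) ('d phi (y t) (derive1 y t))).
  apply: (@is_derive_curve _ _ _ (fun z => 'd psi z v) (fun s => phi (y s))).
    by apply: is_derive_curve => //; exact: dphi.
  by case: cpsi => _ /(_ v) [+ _]; apply; exact: AB.
set V' := 'd (fun z => 'd psi z v) _ _ in dV.
have VE x : A x -> 'd phi x ('d psi (phi x) v) = v.
  move=> Ax.
  have dphi' := dphi _ (BA _ (AB _ Ax)).
  have dc := differentiable_comp (dpsi _ (AB _ Ax)) dphi'.
  have nE : {near phi x, phi \o psi =1 id}.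
    by near=> z; apply: phiK; near: z; apply: open_nbhs_nbhs; split => //; exact: AB.
  have [_ E] := near_eq_is_diff nE dc.
  have E2 := diff_comp (dpsi _ (AB _ Ax)) dphi'.
  have [_ E3] := is_diff_id (phi x).
  have := etrans (etrans (esym (congr1 (@^~ v) E2)) (esym (congr1 (@^~ v) E)))
    (congr1 (@^~ v) E3).
  by move=> /= E4; rewrite psiK in E4.
(* Chain rule for [l0], which is [l] composed with the tangent map of [phi]. *)
have dl0 x w a b : A x -> differentiable (uncurried l0) (x, w) /\
    'd (uncurried l0) (x, w) (a, b) =
    'd (uncurried l) (phi x, 'd phi x w)
      ('d phi x a, 'd (fun z => 'd phi z w) x a + 'd phi x b).
  move=> Ax.
  have [dT TE] := is_diff_tangent w a b oA Ax cphi.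
  have d1 : differentiable (fun q : rV * rV => phi q.1) (x, w).
    by apply: (@differentiable_comp _ _ _ _ fst phi); [case: (@Cr_fst _ rV rV 1 setT) => + _; exact|exact: dphi].
  have dP := differentiable_pair d1 dT.
  have dlx := dl (phi x) ('d phi x w) (AB _ Ax).
  have dC := differentiable_comp dP (dlx : differentiable (uncurried l) ((fun q : rV * rV => (phi q.1, 'd phi (q.1) (q.2))) (x, w))).
  have nE : {near (x, w), uncurried l \o (fun q : rV * rV => (phi q.1, 'd phi (q.1) (q.2))) =1 uncurried l0}.
    near=> q; rewrite /uncurried /= l0E //.
    by near: q; apply: (@open_nbhs_nbhs _ (x, w) [set q | A q.1]); split => //; exact: open_fst.
  have [d0 E] := near_eq_is_diff nE dC.
  split; first exact: d0.
  have F1 : 'd (fun q : rV * rV => phi q.1) (x, w) (a, b) = 'd phi x a.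
    have [_ _ _ _ F] := diff_fst_snd a b d1.
    apply: (etrans F); apply: etrans (addr0 _).
    exact: (congr1 (fun u => 'd phi x a + u) (congr1 (@^~ b) (diff_cst (phi x) w))).
  apply: (etrans (congr1 (@^~ (a, b)) E)).
  apply: (etrans (congr1 (@^~ (a, b)) (diff_comp dP dlx))).
  apply: (congr1 ('d (uncurried l) (phi x, 'd phi x w))).
  apply: (etrans (congr1 (@^~ (a, b)) (diff_pair d1 dT))).
  exact: (f_equal2 pair F1 TE).
have nd0 : \forall s \near t, differentiable (uncurried l0) (y s, derive1 y s).
  by apply: filterS nA => s As; case: (dl0 (y s) (derive1 y s) 0 0 As).
have M := EL_moving nd0 el dV.
have dyE s : A (y s) -> is_derive s (1:R) y (derive1 y s) ->
    derive1 (phi \o y) s = 'd phi (y s) (derive1 y s).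
  by move=> As ds; rewrite derive1E; case: (is_derive_curve ds (dphi _ As)).
have vE : 'd (fun z => 'd phi z (derive1 y t)) (y t) (V t) + 'd phi (y t) V' = 0.
  have H := is_derive_tangent oA Ay cphi dyt dV.
  have K : is_derive t (1:R) (fun s => 'd phi (y s) (V s)) 0.
    apply: near_eq_is_derive (is_derive_cst v t (1:R)).
    by apply: filterS nA => s As; rewrite VE.
  have S := schwarz (V t) (derive1 y t) oA Ay cphi.
  have e1 := @derive_val _ _ _ _ _ _ _ H.
  have e2 := @derive_val _ _ _ _ _ _ _ K.
  apply: (etrans (congr1 (fun u => u + 'd phi (y t) V') (esym S))).
  exact: (etrans (esym e1) e2).
have phidl x w : A x -> differentiable (uncurried l) (phi x, w) by move=> /AB/dl.
have Rhs : 'd (uncurried l0) (y t, derive1 y t) (V t, V') =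
    'D_v (fun z => l z (derive1 (phi \o y) t)) ((phi \o y) t).
  have [_ E] := dl0 (y t) (derive1 y t) (V t) V' Ay.
  apply: (etrans E).
  rewrite (dyE t Ay dyt) (derive_fst v (phidl _ _ Ay)).
  apply: (congr1 ('d (uncurried l) _)).
  exact: (f_equal2 pair (VE _ Ay) vE).
apply: (is_derive_eq _ Rhs).
have nE : \forall s \near t, 'd (uncurried l0) (y s, derive1 y s) (0, V s) =
    'D_v (fun w => l ((phi \o y) s) w) (derive1 (phi \o y) s).
  near=> s.
  have As : A (y s) by near: s.
  have ds : is_derive s (1:R) y (derive1 y s) by near: s.
  have [_ E] := dl0 (y s) (derive1 y s) 0 (V s) As.
  apply: (etrans E).
  rewrite (dyE s As ds) (derive_snd v (phidl _ _ As)).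
  apply: (congr1 ('d (uncurried l) _)); apply: (f_equal2 pair).
    exact: linear0.
  have D0 : 'd (fun z => 'd phi z (derive1 y s)) (y s) 0 = 0 by exact: linear0.
  exact: (etrans (f_equal2 (fun a b => a + b) D0 (VE _ As)) (add0r v)).
exact: near_eq_is_derive nE M.
Unshelve. all: by end_near. Qed.

End EulerLagrange.

(** * Mechanical Lagrangians with a magnetic term *)

Section CurveRegularity.
Context {R : realType}.

(** [Cr] speaks of ['d y t v] for every real [v], that is of [v] times the velocity; the scalings by
    [v] and [w] account for this. *)
Lemma Cr2_curve n (J : set R) (y a : R -> 'rV[R]_n) : open J ->
  (forall t, J t -> is_derive t (1:R) y (derive1 y t)) ->
  (forall t, J t -> is_derive t (1:R) (derive1 y) (a t)) ->
  (forall t, J t -> {for t, continuous a}) -> Cr 2 J y.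
Proof.
move=> oJ dy d2y ca.
have E (f f' : R -> 'rV[R]_n) t v : is_derive t (1:R) f (f' t) ->
    differentiable f t /\ 'd f t v = v *: f' t.
  move=> [/derivable1_diffP df <-]; split => //.
  rewrite deriveE // -[X in 'd _ _ X = _]mulr1.
  by rewrite [LHS]linearZ.
split=> [t Jt|v]; first by case: (E _ _ t 0 (dy t Jt)).
have H : Cr 1 J (fun t => v *: derive1 y t).
  split=> [t Jt|w].
    by apply: differentiableZ; case: (E _ _ t 0 (d2y t Jt)).
  have H0 : Cr 0 J (fun t => v *: (w *: a t)).
    by move=> t Jt; apply: cvgZl_tmp; apply: cvgZl_tmp; exact: ca.
  apply: (Cr_eq oJ _ H0) => t Jt; have [df <-] := E _ _ t w (d2y t Jt).
  exact: esym (congr1 (@^~ w) (diffZ v df)).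
by apply: (Cr_eq oJ _ H) => t Jt; case: (E _ _ t v (dy t Jt)).
Qed.

Lemma is_derive_coordV n (x v : 'rV[R]_n) i : is_derive x v (fun w => w 0 i) (v 0 i).
Proof.
have d := @derivable_id R _ x v.
apply: DeriveDef; first by move/derivable_mxP : d.
have /rowP/(_ i) := derive_mx d.
by rewrite derive_id mxE.
Qed.

End CurveRegularity.

Section Mechanical.
Context {R : realType} {n : nat}.
Local Notation rV := 'rV[R]_n.
Variables (A : set rV) (B : 'I_n -> 'I_n -> rV -> R) (m : 'I_n -> rV -> R) (u : rV -> R).

(** Written as a double sum over a family of coefficients, so that coefficients depending on a point
    can be differentiated term by term; [bform_mx] gives the matrix form. *)
Definition bform (b : 'I_n -> 'I_n -> R) (v w : rV) : R :=
  \sum_i \sum_j b i j * (v 0 i * w 0 j).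

Definition lform (c : 'I_n -> R) (w : rV) : R := \sum_i c i * w 0 i.

Definition mech (y w : rV) : R :=
  2^-1 * bform (fun i j => B i j y) w w + lform (m ^~ y) w - u y.

Hypothesis oA : open A.
Hypothesis cB : forall i j, Cr 2 A (B i j).
Hypothesis cm : forall i, Cr 2 A (m i).
Hypothesis cu : Cr 2 A u.
Hypothesis Bsym : forall i j y, A y -> B i j y = B j i y.
Hypothesis Bpos : forall y w, A y -> w != 0 -> 0 < bform (fun i j => B i j y) w w.

Let dB i j y : A y -> differentiable (B i j) y.
Proof. by move=> Ay; have [+ _] := cB i j; exact. Qed.
Let dm i y : A y -> differentiable (m i) y.
Proof. by move=> Ay; have [+ _] := cm i; exact. Qed.
Let du y : A y -> differentiable u y.
Proof. by move=> Ay; have [+ _] := cu; exact. Qed.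

Lemma mech_Cr : Cr 2 [set q : rV * rV | A q.1] (uncurried mech).
Proof.
have oO := @open_fst _ rV rV _ oA.
have comp (f : rV -> R) : Cr 2 A f -> Cr 2 [set q : rV * rV | A q.1] (fun q => f q.1).
  by move=> cf; apply: (Cr_comp oO _ (Cr_fst _ _) cf).
have snd_i i : Cr 2 [set q : rV * rV | A q.1] (fun q => q.2 0 i).
  by apply: Cr_coord => //; exact: Cr_snd.
apply: (CrB oO _ (comp _ cu)); apply: (CrD oO).
  apply: (Cr_mul oO (Cr_cst _ _ _)).
  apply: (Cr_sum _ oO) => i _; apply: (Cr_sum _ oO) => j _.
  exact: (Cr_mul oO (comp _ (cB i j)) (Cr_mul oO (snd_i i) (snd_i j))).
apply: (Cr_sum _ oO) => i _; exact: (Cr_mul oO (comp _ (cm i)) (snd_i i)).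
Qed.

Lemma mech_differentiable y w : A y -> differentiable (uncurried mech) (y, w).
Proof. by move=> Ay; have [+ _] := mech_Cr; exact. Qed.

Lemma bformC y v w : A y ->
  bform (fun i j => B i j y) v w = bform (fun i j => B i j y) w v.
Proof.
move=> Ay; rewrite /bform exchange_big /=; apply: eq_bigr => i _.
by apply: eq_bigr => j _; rewrite Bsym // [X in _ * X]mulrC.
Qed.

Lemma mech_derive_snd y w v : A y ->
  'D_v (fun w => mech y w) w = bform (fun i j => B i j y) w v + lform (m ^~ y) v.
Proof.
move=> Ay.
have cst_mul (c : R) (f : rV -> R) df : is_derive w v f df ->
    is_derive w v (fun z => c * f z) (c * df).
  move=> H; have := is_derive_mul (is_derive_cst c w v) H.
  by rewrite mul0r add0r.
have H1 : is_derive w v (fun w => bform (fun i j => B i j y) w w)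
    (\sum_i \sum_j B i j y * (v 0 i * w 0 j + w 0 i * v 0 j)).
  apply: is_derive_bigsum => i; apply: is_derive_bigsum => j.
  by apply: cst_mul; apply: is_derive_mul; exact: is_derive_coordV.
have H2 : is_derive w v (lform (m ^~ y)) (lform (m ^~ y) v).
  by apply: is_derive_bigsum => i; apply: cst_mul; exact: is_derive_coordV.
have [_ ->] := is_deriveB (is_deriveD (cst_mul 2^-1 _ _ H1) H2) (is_derive_cst (u y) w v).
rewrite subr0; congr (_ + _).
rewrite (_ : \sum_i _ = bform (fun i j => B i j y) v w + bform (fun i j => B i j y) w v).
  rewrite (bformC v w Ay); lra.
rewrite /bform -big_split /=; apply: eq_bigr => i _; rewrite -big_split /=.
by apply: eq_bigr => j _; rewrite mulrDr.
Qed.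

Definition mech_force (y w v : rV) : R :=
  2^-1 * bform (fun i j => 'd (B i j) y v) w w +
  lform (fun i => 'd (m i) y v) w - 'd u y v.

Lemma mech_derive_fst y w v : A y ->
  'D_v (fun z => mech z w) y = mech_force y w v.
Proof.
move=> Ay.
have mul_cst (c : R) (f : rV -> R) df : is_derive y v f df ->
    is_derive y v (fun z => f z * c) (df * c).
  move=> H; have := is_derive_mul H (is_derive_cst c y v).
  by rewrite mulr0 addr0.
have H1 : is_derive y v (fun z => bform (fun i j => B i j z) w w)
    (bform (fun i j => 'd (B i j) y v) w w).
  apply: is_derive_bigsum => i; apply: is_derive_bigsum => j.
  by apply: mul_cst; apply: is_derive_diff; exact: dB.
have H2 : is_derive y v (fun z => lform (m ^~ z) w) (lform (fun i => 'd (m i) y v) w).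
  by apply: is_derive_bigsum => i; apply: mul_cst; apply: is_derive_diff; exact: dm.
have H3 : is_derive y v u ('d u y v) by apply: is_derive_diff; exact: du.
have H1' := is_derive_mul (is_derive_cst (2^-1 : R) y v) H1.
have H := is_deriveB (is_deriveD H1' H2) H3.
by rewrite /mech_force -[2^-1 * _]add0r -[X in X + _ * _](mul0r (bform (fun i j => B i j y) w w));
  exact: (@derive_val _ _ _ _ _ _ _ H).
Qed.

Lemma mech_force_sum y w v : A y ->
  mech_force y w v = \sum_j mech_force y w (delta_mx 0 j) * v 0 j.
Proof.
move=> Ay; rewrite -mech_derive_fst //.
have [d1 _ _ _ _] := diff_fst_snd 0 0 (mech_differentiable w Ay).
rewrite deriveE //.
have E := diff_rVE (fun z => uncurried mech (z, w)) y v.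
apply: (etrans E); apply: eq_bigr => j _.
by rewrite -mech_derive_fst // deriveE // mulrC.
Qed.

Definition Bmx y : 'M[R]_n := \matrix_(i, j) B i j y.

Lemma bform_mx y v w :
  bform (fun i j => B i j y) v w = \sum_j (v *m Bmx y) 0 j * w 0 j.
Proof.
rewrite /bform exchange_big /=; apply: eq_bigr => j _.
by rewrite mxE mulr_suml; apply: eq_bigr => i _; rewrite mxE mulrCA mulrA.
Qed.

Lemma Bmx_det_neq0 y : A y -> \det (Bmx y) != 0.
Proof.
move=> Ay; apply/det0P => -[v v0 vB].
by have := Bpos Ay v0; rewrite bform_mx vB big1 ?ltxx // => j _; rewrite mxE mul0r.
Qed.

(** Expanding [d/dt (w B + m)] and moving to the other side everything but the acceleration term,
    the Euler-Lagrange equations become [w' *m Bmx y = residual y w]. *)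
Definition residual y w : rV :=
  \row_j (mech_force y w (delta_mx 0 j) -
          \sum_i 'd (B i j) y w * w 0 i - 'd (m j) y w).

(** The solution by Cramer's rule, a form in which regularity follows from that of determinants and
    cofactors. *)
Definition accel y w : rV := (\det (Bmx y))^-1 *: (residual y w *m \adj (Bmx y)).

Lemma accelE y w : A y -> accel y w *m Bmx y = residual y w.
Proof.
move=> Ay; rewrite /accel -scalemxAl -mulmxA mul_adj_mx mul_mx_scalar scalerA.
by rewrite mulVf ?scale1r // Bmx_det_neq0.
Qed.

(** The acceleration involves first derivatives of [C^2] coefficients, so it is [C^1], exactly what
    [picard] asks for. Position and velocity are functions [h] and [k] of a parameter, to fit the
    single state vector of the first-order system. *)
Lemma accel_Cr (V : normedModType R) (Om : set V) (h k : V -> rV) i : open Om ->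
  (forall z, Om z -> A (h z)) -> Cr 1 Om h -> Cr 1 Om k ->
  Cr 1 Om (fun z => accel (h z) (k z) 0 i).
Proof.
move=> oO OA ch ck.
have comp (f : rV -> R) : Cr 2 A f -> Cr 1 Om (fun z => f (h z)).
  by move=> cf; apply: (Cr_comp oO OA ch); exact: (Cr_le (leqnSn 1)).
have diffc (f : rV -> R) v : Cr 2 A f -> Cr 1 Om v -> Cr 1 Om (fun z => 'd f (h z) (v z)).
  by move=> cf cv; exact: (Cr_diff_comp oO OA cf ch cv).
have kc j : Cr 1 Om (fun z => k z 0 j) by exact: Cr_coord.
have ec j : Cr 1 Om (fun=> delta_mx 0 j : rV) by exact: Cr_cst.
have cBc a b : Cr 1 Om (fun z => Bmx (h z) a b).
  by apply: (@Cr_ext _ _ _ _ _ (fun z => B a b (h z))) (comp _ (cB a b)) => z; rewrite mxE.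
have cd : Cr 1 Om (fun z => \det (Bmx (h z))) by apply: (Cr_det oO).
have cad a b : Cr 1 Om (fun z => \adj (Bmx (h z)) a b) by apply: (Cr_adj _ _ oO).
have cr j : Cr 1 Om (fun z => residual (h z) (k z) 0 j).
  apply: (@Cr_ext _ _ _ _ _ (fun z => mech_force (h z) (k z) (delta_mx 0 j) -
          \sum_i 'd (B i j) (h z) (k z) * k z 0 i - 'd (m j) (h z) (k z))).
    by move=> z; rewrite mxE.
  apply: (CrB oO _ (diffc _ _ (cm j) ck)); apply: (CrB oO); last first.
    by apply: (Cr_sum _ oO) => i' _; exact: (Cr_mul oO (diffc _ _ (cB i' j) ck) (kc i')).
  apply: (CrB oO _ (diffc _ _ cu (ec j))); apply: (CrD oO).
    apply: (Cr_mul oO (Cr_cst _ _ _)).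
    apply: (Cr_sum _ oO) => a _; apply: (Cr_sum _ oO) => b _.
    exact: (Cr_mul oO (diffc _ _ (cB a b) (ec j)) (Cr_mul oO (kc a) (kc b))).
  by apply: (Cr_sum _ oO) => a _; exact: (Cr_mul oO (diffc _ _ (cm a) (ec j)) (kc a)).
apply: (@Cr_ext _ _ _ _ _ (fun z => (\det (Bmx (h z)))^-1 *
    \sum_j residual (h z) (k z) 0 j * \adj (Bmx (h z)) j i)).
  by move=> z; rewrite !mxE.
apply: (Cr_mul oO).
  by apply: (CrV oO _ cd) => z Oz; exact/Bmx_det_neq0/OA.
by apply: (Cr_sum _ oO) => j _; exact: (Cr_mul oO (cr j) (cad j i)).
Qed.

(** Differentiating the momentum along the curve produces, besides the acceleration term, precisely
    the terms that [residual] subtracts from the force; [accelE] then closes the equation. *)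
Lemma mech_EL y (t : R) w' : A (y t) ->
  (\forall s \near t, is_derive s (1:R) y (derive1 y s)) ->
  is_derive t (1:R) (derive1 y) w' -> w' = accel (y t) (derive1 y t) ->
  EL_at mech y t.
Proof.
move=> Ay dy dw w'E v; have dyt := nbhs_singleton dy.
have nA : \forall s \near t, A (y s).
  by apply: (is_derive_continuous dyt); exact: open_nbhs_nbhs.
have nE : \forall s \near t,
    \sum_i \sum_j B i j (y s) * (derive1 y s 0 i * v 0 j) + \sum_j m j (y s) * v 0 j =
    'D_v (fun w => mech (y s) w) (derive1 y s).
  by apply: filterS nA => s As; exact: (esym (mech_derive_snd _ _ As)).
apply: (near_eq_is_derive nE).
have mul_cst (c : R) (f : R -> R) df : is_derive t (1:R) f df ->
    is_derive t (1:R) (fun z => f z * c) (df * c).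
  move=> H; have := is_derive_mul H (is_derive_cst c t (1:R)).
  by rewrite mulr0 addr0.
have dBt i j := is_derive_curve dyt (dB i j Ay).
have dmt i := is_derive_curve dyt (dm i Ay).
have H1 : is_derive t (1:R)
    (fun s => \sum_i \sum_j B i j (y s) * (derive1 y s 0 i * v 0 j))
    (\sum_i \sum_j ('d (B i j) (y t) (derive1 y t) * (derive1 y t 0 i * v 0 j) +
       B i j (y t) * (w' 0 i * v 0 j))).
  apply: is_derive_bigsum => i; apply: is_derive_bigsum => j.
  by apply: is_derive_mul => //; apply: mul_cst; exact: is_derive_coord.
have H2 : is_derive t (1:R) (fun s => \sum_j m j (y s) * v 0 j)
    (\sum_j 'd (m j) (y t) (derive1 y t) * v 0 j).
  by apply: is_derive_bigsum => j; exact: mul_cst.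
apply: is_derive_eq (is_deriveD H1 H2) _.
rewrite mech_derive_fst // mech_force_sum // exchange_big -big_split /=.
apply: eq_bigr => j _.
have := congr1 (fun z : rV => z 0 j) (accelE (derive1 y t) Ay).
rewrite -w'E !mxE => E.
rewrite (_ : mech_force _ _ _ = \sum_i w' 0 i * Bmx (y t) i j +
  \sum_i 'd (B i j) (y t) (derive1 y t) * derive1 y t 0 i +
  'd (m j) (y t) (derive1 y t)); last first.
  have gen (a b c : R) : a = a - b - c + b + c by ring.
  rewrite E; exact: gen.
rewrite mulrDl; congr (_ + _).
rewrite -big_split mulr_suml; apply: eq_bigr => i _ /=.
by rewrite mxE mulrDl addrC !mulrA [w' 0 i * _]mulrC.
Qed.

(** The second-order equation is turned into the system [(y, w)' = (w, accel y w)] on concatenated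
    row vectors. *)
Lemma mech_solution y0 w0 : A y0 ->
  exists T, 0 < T /\ exists y : R -> rV,
    [/\ y 0 = y0, derive1 y 0 = w0, Cr 2 [set t | `|t| < T] y &
     forall t, `|t| < T -> [/\ A (y t), is_derive t (1:R) y (derive1 y t),
       is_derive t (1:R) (derive1 y) (accel (y t) (derive1 y t)) & EL_at mech y t]].
Proof.
move=> Ay0.
pose Om := [set z : 'rV[R]_(n + n) | A (lsubmx z)].
have cl r (X : set 'rV[R]_(n + n)) : open X -> Cr r X (fun z : 'rV[R]_(n + n) => (lsubmx z : rV)).
  move=> oX; apply: Cr_rV => // i; apply: (@Cr_ext _ _ _ _ _ (fun z : 'rV_(n + n) => z 0 (lshift n i))).
    by move=> z; rewrite mxE.
  by apply: Cr_coord => //; exact: Cr_id.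
have cr r (X : set 'rV[R]_(n + n)) : open X -> Cr r X (fun z : 'rV[R]_(n + n) => (rsubmx z : rV)).
  move=> oX; apply: Cr_rV => // i; apply: (@Cr_ext _ _ _ _ _ (fun z : 'rV_(n + n) => z 0 (rshift n i))).
    by move=> z; rewrite mxE.
  by apply: Cr_coord => //; exact: Cr_id.
have oO : open Om.
  apply: (@open_comp _ _ (fun z : 'rV[R]_(n + n) => (lsubmx z : rV))) => // z _.
  exact: (cl 0 setT openT).
pose f (z : 'rV[R]_(n + n)) : 'rV[R]_(n + n) :=
  row_mx (rsubmx z) (accel (lsubmx z) (rsubmx z)).
have cf i : Cr 1 Om (fun z => f z 0 i).
  case: (split_ordP i) => j ->.
    apply: (@Cr_ext _ _ _ _ _ (fun z : 'rV[R]_(n + n) => (rsubmx z : rV) 0 j)) => [z|]; first by rewrite row_mxEl.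
    by apply: Cr_coord => //; exact: cr.
  apply: (@Cr_ext _ _ _ _ _ (fun z : 'rV[R]_(n + n) => accel (lsubmx z) (rsubmx z) 0 j)) => [z|].
    by rewrite row_mxEr.
  by apply: accel_Cr => //; [exact: cl|exact: cr].
have Oz0 : Om (row_mx y0 w0) by rewrite /Om /= row_mxKl.
have [T [T0 [z [z0 Hz]]]] := picard oO Oz0 cf.
pose y t := lsubmx (z t) : rV; pose w t := rsubmx (z t) : rV.
have dy t : `|t| < T -> is_derive t (1:R) y (w t).
  move=> tT; have [_ dz] := Hz t tT; apply: is_derive_rV => i.
  have := is_derive_coord (lshift n i) dz; rewrite /f row_mxEl => h.
  by rewrite (_ : (fun s => _) = (fun s => z s 0 (lshift n i))) //; apply/funext => s; rewrite mxE.
have dw t : `|t| < T -> is_derive t (1:R) w (accel (y t) (w t)).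
  move=> tT; have [_ dz] := Hz t tT; apply: is_derive_rV => i.
  have := is_derive_coord (rshift n i) dz; rewrite /f row_mxEr => h.
  by rewrite (_ : (fun s => _) = (fun s => z s 0 (rshift n i))) //; apply/funext => s; rewrite mxE.
have yE t : `|t| < T -> derive1 y t = w t.
  by move=> tT; rewrite derive1E; case: (dy t tT).
have oJ : open [set t : R | `|t| < T].
  rewrite (_ : [set t | _] = ball (0:R) T) //; first exact: ball_open.
  by apply/seteqP; split=> s /=; rewrite -ball_normE /= sub0r normrN.
have nE t : `|t| < T -> \forall s \near t, w s = derive1 y s.
  move=> tT; have : \forall s \near t, `|s| < T by exact: open_nbhs_nbhs.
  by apply: filterS => s sT; rewrite yE.
have dw' t : `|t| < T -> is_derive t (1:R) (derive1 y) (accel (y t) (derive1 y t)).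
  by move=> tT; rewrite yE //; exact: (near_eq_is_derive (nE t tT) (dw t tT)).
have dy' t : `|t| < T -> is_derive t (1:R) y (derive1 y t).
  by move=> tT; rewrite yE //; exact: dy.
have Ayt t : `|t| < T -> A (y t) by move=> /Hz[].
exists T; split => //; exists y.
have y0E : y 0 = y0 by rewrite /y z0 row_mxKl.
split; first exact: y0E.
- by rewrite yE ?normr0 // /w z0 row_mxKr.
- apply: (@Cr2_curve _ _ _ y (fun t => accel (y t) (w t)) oJ dy').
    by move=> t tT; rewrite -yE //; exact: dw'.
  move=> t tT; apply: (@continuous_comp _ _ _ z (fun z => accel (lsubmx z) (rsubmx z))).
    by have [_ /is_derive_continuous] := Hz t tT.
  have [Oz _] := Hz t tT.
  have : Cr 1 Om (fun z => accel (lsubmx z) (rsubmx z)).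
    by apply: Cr_rV => // i; apply: accel_Cr => //; [exact: cl|exact: cr].
  by move=> /(Cr_le (leqnSn 0)); apply.
move=> t tT; split; [exact: Ayt|exact: dy'|exact: dw'|].
apply: (mech_EL (Ayt t tT) _ (dw' t tT)) => //.
have : \forall s \near t, `|s| < T by exact: open_nbhs_nbhs.
by apply: filterS => s; exact: dy'.
Qed.

End Mechanical.

(** * Escape from a degenerate minimum *)

Section FormBounds.
Context {R : realType}.

Lemma near_sum_dist (V : normedModType R) (I : finType) (f : I -> V -> R) x (e : R) :
  (forall i, {for x, continuous (f i)}) -> 0 < e ->
  \forall z \near x, \sum_i `|f i z - f i x| <= e.
Proof.
move=> cf e0; pose N : R := #|I|%:R + 1.
have N0 : 0 < N by rewrite ltr_wpDl.
have H : \forall z \near x, forall i, `|f i z - f i x| <= e / N.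
  apply: (@filter_forall _ _ (fun i z => `|f i z - f i x| <= e / N) (nbhs x) _) => i.
  have /cvgrPdist_le /(_ _ (divr_gt0 e0 N0)) := cf i.
  by apply: filterS => z; rewrite distrC.
apply: filterS H => z Hz.
have : \sum_i `|f i z - f i x| <= \sum_(i : I) e / N by apply: ler_sum.
move=> /le_trans; apply; rewrite sumr_const -mulr_natr -mulrA.
rewrite ger_pMr // mulrC ler_pdivrMr // mul1r /N lerDl //.
Qed.

Lemma near_sum_bound (V : normedModType R) (I : finType) (f : I -> V -> R) x :
  (forall i, {for x, continuous (f i)}) ->
  \forall z \near x, \sum_i `|f i z| <= \sum_i `|f i x| + 1.
Proof.
move=> /near_sum_dist /(_ ltr01); apply: filterS => z H.
rewrite addrC; apply: le_trans (lerD H (lexx _)).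
rewrite -big_split /=; apply: ler_sum => i _.
by rewrite -{1}(subrK (f i x) (f i z)) ler_normD.
Qed.

Lemma bform_norm n (b : 'I_n -> 'I_n -> R) (v w : 'rV[R]_n) :
  `|bform b v w| <= (\sum_(p : 'I_n * 'I_n) `|b p.1 p.2|) * (`|v| * `|w|).
Proof.
rewrite /bform pair_bigA /= mulr_suml; apply: le_trans (ler_norm_sum _ _ _) _.
apply: ler_sum => p _; rewrite normrM ler_wpM2l // normrM.
by apply: ler_pM => //; exact: rV_norm_ge.
Qed.

Lemma lform_norm n (c : 'I_n -> R) (w : 'rV[R]_n) :
  `|lform c w| <= (\sum_i `|c i|) * `|w|.
Proof.
rewrite /lform mulr_suml; apply: le_trans (ler_norm_sum _ _ _) _.
apply: ler_sum => p _; rewrite normrM ler_wpM2l //; exact: rV_norm_ge.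
Qed.

Lemma bformZ n (b : 'I_n -> 'I_n -> R) (v w : 'rV[R]_n) (a c : R) :
  bform b (a *: v) (c *: w) = a * c * bform b v w.
Proof.
rewrite /bform mulr_sumr; apply: eq_bigr => i _; rewrite mulr_sumr.
by apply: eq_bigr => j _; rewrite !mxE; ring.
Qed.

Lemma bformB n (b b' : 'I_n -> 'I_n -> R) (v w : 'rV[R]_n) :
  bform b v w - bform b' v w = bform (fun i j => b i j - b' i j) v w.
Proof.
rewrite /bform -sumrB; apply: eq_bigr => i _; rewrite -sumrB.
by apply: eq_bigr => j _; rewrite mulrBl.
Qed.

(** The constant is the minimum of the form on the unit sphere, which is compact; [v0] ensures that
    the sphere is nonempty. *)
Lemma bform_coercive n (b : 'I_n -> 'I_n -> R) (v0 : 'rV[R]_n) : v0 != 0 ->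
  (forall w, w != 0 -> 0 < bform b w w) ->
  exists2 c, 0 < c & forall w, c * `|w| ^+ 2 <= bform b w w.
Proof.
move=> v0n bpos.
have nz (w : 'rV[R]_n) : w != 0 -> `| `|w|^-1 *: w| = 1.
  move=> w0; rewrite normrZ ger0_norm ?invr_ge0 // mulVf // normr_eq0 //.
pose S : set 'rV[R]_n := [set w | `|w| = 1].
have S0 : S !=set0 by exists (`|v0|^-1 *: v0); exact: nz.
have cS : compact S.
  apply: bounded_closed_compact.
    exists 1; split; first exact: ger0_real.
    by move=> M M1 w /= ->; exact: ltW.
  have -> : S = (fun w : 'rV[R]_n => `|w|) @^-1` [set 1] by [].
  apply: closed_comp; last exact: closed_eq.
  by move=> w _; exact: norm_continuous.
have cb : Cr 0 setT (fun w : 'rV[R]_n => bform b w w).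
  apply: (Cr_sum _ openT) => i _; apply: (Cr_sum _ openT) => j _.
  apply: (Cr_mul openT (Cr_cst _ _ _)); apply: (Cr_mul openT).
    exact: (Cr_coord i openT (Cr_id _ _)).
  exact: (Cr_coord j openT (Cr_id _ _)).
have [] := @EVT_min_rV R n (fun w => bform b w w) S S0 cS.
  by apply: continuous_subspaceT => w; exact: cb.
move=> c cinS cmin; rewrite inE /S /= in cinS.
have c0 : c != 0 by rewrite -normr_eq0 cinS oner_neq0.
exists (bform b c c); first exact: bpos.
move=> w; have [->|w0] := eqVneq w 0.
  by rewrite normr0 expr0n /= mulr0 /bform big1 // => i _; rewrite big1 // => j _; rewrite mxE mul0r mulr0.
have := cmin (`|w|^-1 *: w); rewrite inE /S /= => /(_ (nz _ w0)).
have w1 : 0 < `|w| by rewrite normr_gt0.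
rewrite bformZ -expr2 exprVn mulrC ler_pdivlMr // exprn_gt0 //.
Qed.

(** Half of the coercivity constant at [y0] survives where the coefficients have moved by at most
    the other half in total. *)
Lemma near_bform_coercive n (B : 'I_n -> 'I_n -> 'rV[R]_n -> R) (v0 y0 : 'rV[R]_n) :
  v0 != 0 -> (forall i j, {for y0, continuous (B i j)}) ->
  (forall w, w != 0 -> 0 < bform (fun i j => B i j y0) w w) ->
  exists2 c, 0 < c & \forall y \near y0, forall w,
    c * `|w| ^+ 2 <= bform (fun i j => B i j y) w w.
Proof.
move=> v00 cB Bpos; have [c c0 Hc] := bform_coercive v00 Bpos.
exists (c / 2); first by rewrite divr_gt0.
have c20 : 0 < c / 2 by rewrite divr_gt0.
have := @near_sum_dist _ _ (fun p : 'I_n * 'I_n => B p.1 p.2) y0 _ (fun p => cB p.1 p.2) c20.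
apply: filterS => y H w; have Hw := Hc w.
have D := bform_norm (fun i j => B i j y - B i j y0) w w; rewrite -bformB -expr2 in D.
have D2 : (\sum_(p : 'I_n * 'I_n) `|B p.1 p.2 y - B p.1 p.2 y0|) * `|w| ^+ 2 <=
  c / 2 * `|w| ^+ 2 by rewrite ler_wpM2r // exprn_ge0.
have := le_trans D D2; rewrite ler_norml => /andP[H1 _].
lra.
Qed.

End FormBounds.

(** * Energy, momentum along the level sets, and the escape estimate *)

Section Escape.
Context {R : realType} {n : nat}.
Local Notation rV := 'rV[R]_n.
Variables (A : set rV) (B : 'I_n -> 'I_n -> rV -> R) (m : 'I_n -> rV -> R) (u : rV -> R).
Hypothesis oA : open A.
Hypothesis cB : forall i j, Cr 2 A (B i j).
Hypothesis cm : forall i, Cr 2 A (m i).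
Hypothesis cu : Cr 2 A u.
Hypothesis Bsym : forall i j y, A y -> B i j y = B j i y.
Hypothesis Bpos : forall y w, A y -> w != 0 -> 0 < bform (fun i j => B i j y) w w.

Local Notation L := (mech B m u).
Local Notation Bf y := (bform (fun i j => B i j y)).

Lemma mech_diffE y w a b : A y -> 'd (uncurried L) (y, w) (a, b) =
  mech_force B m u y w a + (Bf y w b + lform (m ^~ y) b).
Proof.
move=> Ay.
have dL := mech_differentiable oA cB cm cu w Ay.
have [d1 d2 _ _ E] := diff_fst_snd a b dL.
apply: (etrans E); rewrite -(mech_derive_fst cB cm cu w a Ay).
rewrite -(mech_derive_snd m u Bsym w b Ay).
by rewrite [in RHS]deriveE // [in RHS]deriveE.
Qed.

(** The energy is the momentum along the velocity minus the Lagrangian. [EL_moving] gives the first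
    term the same derivative as the chain rule gives the second, and the magnetic term, linear in
    the velocity, cancels from the energy. *)
Lemma mech_energy y (t : R) w' : A (y t) ->
  is_derive t (1:R) y (derive1 y t) -> is_derive t (1:R) (derive1 y) w' ->
  EL_at L y t ->
  is_derive t (1:R)
    (fun s => 2^-1 * Bf (y s) (derive1 y s) (derive1 y s) + u (y s)) 0.
Proof.
move=> Ay dy dw el.
have nA : \forall s \near t, A (y s).
  by apply: (is_derive_continuous dy); exact: open_nbhs_nbhs.
have nd : \forall s \near t, differentiable (uncurried L) (y s, derive1 y s).
  by apply: filterS nA => s As; exact: (mech_differentiable oA cB cm cu).
have H1 := EL_moving nd el dw.
have dL := mech_differentiable oA cB cm cu (derive1 y t) Ay.
have H2 := is_derive_curve (is_derive_pair dy dw) dL.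
have := is_deriveB H1 H2; rewrite subrr; apply: near_eq_is_derive.
apply: filterS nA => s As.
have E := mech_diffE (derive1 y s) 0 (derive1 y s) As.
apply: (etrans (congr1 (fun z => z - uncurried L (y s, derive1 y s)) E)).
rewrite /uncurried /= /mech /mech_force.
rewrite (_ : bform (fun i j => 'd (B i j) (y s) 0) _ _ = 0); last first.
  by rewrite /bform big1 // => i _; rewrite big1 // => j _; rewrite linear0 mul0r.
rewrite (_ : lform (fun i => 'd (m i) (y s) 0) _ = 0); last first.
  by rewrite /lform big1 // => i _; rewrite linear0 mul0r.
rewrite linear0; lra.
Qed.

Variables (y0 : rV) (v : rV -> rV).
Hypothesis Ay0 : A y0.
Hypothesis cv : Cr 1 A v.
Hypothesis v0 : v y0 != 0.
Hypothesis u_ge0 : forall y, A y -> 0 <= u y.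
Hypothesis u0 : u y0 = 0.
Hypothesis du_v : forall y, A y -> 'd u y (v y) = 0.
Hypothesis m_v : forall y, A y -> lform (m ^~ y) (v y) = 0.
(** In coordinates this says that the contraction of [v] with the exterior derivative of the
    one-form [m] is zero. *)
Hypothesis dm_v : forall y w, A y ->
  lform (fun i => 'd (m i) y (v y)) w = lform (fun i => 'd (m i) y w) (v y).

Let dv y : A y -> differentiable v y.
Proof. by move=> Ay; have [+ _] := cv; exact. Qed.

(** After exchanging the two directions by [dm_v], the magnetic terms add up to the derivative along
    [w] of the pairing of [m] with [v], which is identically zero on [A]. What is left is quadratic
    in [w]. *)
Lemma mech_momentum_rate y w : A y ->
  'd (uncurried L) (y, w) (v y, 'd v y w) =
  2^-1 * bform (fun i j => 'd (B i j) y (v y)) w w + Bf y w ('d v y w).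
Proof.
move=> Ay; have E := mech_diffE w (v y) ('d v y w) Ay.
apply: (etrans E); rewrite /mech_force [X in _ - X + _](du_v Ay) [X in _ + X - _](dm_v w Ay).
suff : lform (fun i => 'd (m i) y w) (v y) + lform (m ^~ y) ('d v y w) = 0 by lra.
have dmi i : is_derive y w (m i) ('d (m i) y w).
  by apply: is_derive_diff; have [+ _] := cm i; exact.
have dvi i : is_derive y w (fun z => v z 0 i) ('d v y w 0 i).
  have [dc dE] := is_diff_coord i (dv Ay).
  by apply: is_derive_eq (is_derive_diff w dc) _; rewrite dE.
have H := is_derive_bigsum (fun i => is_derive_mul (dmi i) (dvi i)).
have K : is_derive y w (fun z => \sum_i m i z * v z 0 i) 0.
  have nE : \forall z \near y, 0 = \sum_i m i z * v z 0 i.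
    have : \forall z \near y, A z by exact: open_nbhs_nbhs.
    by apply: filterS => z Az; exact: esym (m_v Az).
  exact: (near_eq_is_derive nE (is_derive_cst _ _ _)).
have e1 := @derive_val _ _ _ _ _ _ _ H.
have e2 := @derive_val _ _ _ _ _ _ _ K.
by rewrite e1 in e2; rewrite -[RHS]e2 big_split.
Qed.

Lemma near_momentum_rate : exists2 C, 0 <= C & \forall y \near y0, forall w,
  `|'d (uncurried L) (y, w) (v y, 'd v y w)| <= C * `|w| ^+ 2.
Proof.
have nA : \forall y \near y0, A y by exact: open_nbhs_nbhs.
have /choice[K HK] : forall i, exists K, 0 <= K /\ \forall z \near y0, forall w,
    `|'d (fun y => v y 0 i) z w| <= K * `|w|.
  move=> i; have [K K0 H] := Cr1_diff_bound Ay0 (Cr_coord i oA cv).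
  by exists K.
pose Kv := \sum_i K i.
have K0 i : 0 <= K i by case: (HK i).
have Kv0 : 0 <= Kv by apply: sumr_ge0.
have nv : \forall y \near y0, forall w, `|'d v y w| <= Kv * `|w|.
  have H : \forall z \near y0, forall i w, `|'d (fun y => v y 0 i) z w| <= K i * `|w|.
    apply: (@filter_forall _ _ (fun i z => forall w, `|'d (fun y => v y 0 i) z w| <= K i * `|w|) (nbhs y0) _) => i.
    by case: (HK i).
  near=> y; move=> w; have Ay : A y by near: y.
  apply: rV_normP => [|i]; first by rewrite mulr_ge0.
  have [_ dE] := is_diff_coord i (dv Ay).
  have -> : 'd v y w 0 i = 'd (fun y => v y 0 i) y w by rewrite dE.
  have Hy : forall i w, `|'d (fun y => v y 0 i) y w| <= K i * `|w| by near: y; exact: H.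
  apply: (le_trans (Hy i w)); rewrite ler_wpM2r // /Kv (bigD1 i) //= lerDl sumr_ge0 //.
have nB := @near_sum_bound _ _ _ (fun p : 'I_n * 'I_n => B p.1 p.2) y0
  (fun p => Cr_le (isT : (0 <= 2)%N) (cB p.1 p.2) _ Ay0).
have cdB i j : Cr 0 A (fun y => 'd (B i j) y (v y)).
  apply: (Cr_diff_comp oA (fun z Az => Az)); last exact: (Cr_le (leqnSn 0) cv).
    exact: (Cr_le (leqnSn 1) (cB i j)).
  exact: Cr_id.
have ndB := @near_sum_bound _ _ _ (fun (p : 'I_n * 'I_n) y => 'd (B p.1 p.2) y (v y)) y0
  (fun p => cdB p.1 p.2 _ Ay0).
set bB := _ + 1 in nB; set bdB := _ + 1 in ndB.
have bB0 : 0 <= bB by rewrite addr_ge0 // sumr_ge0.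
have bdB0 : 0 <= bdB by rewrite addr_ge0 // sumr_ge0.
exists (bdB + bB * Kv); first by rewrite addr_ge0 // mulr_ge0.
near=> y; move=> w.
have Ay : A y by near: y.
rewrite mech_momentum_rate // mulrDl.
apply: le_trans (ler_normD _ _) _; apply: lerD.
  rewrite normrM ger0_norm ?invr_ge0 //.
  have h1 := bform_norm (fun i j => 'd (B i j) y (v y)) w w.
  have h2 : \sum_(p : 'I_n * 'I_n) `|'d (B p.1 p.2) y (v y)| <= bdB by near: y.
  rewrite -expr2 in h1; have h3 := le_trans h1 (ler_wpM2r (exprn_ge0 2 (normr_ge0 w)) h2).
  have h4 := normr_ge0 (bform (fun i j => 'd (B i j) y (v y)) w w).
  lra.
have h1 := bform_norm (fun i j => B i j y) w ('d v y w).
have h2 : \sum_(p : 'I_n * 'I_n) `|B p.1 p.2 y| <= bB by near: y.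
have hv : forall w, `|'d v y w| <= Kv * `|w| by near: y; exact: nv.
have h3 := hv w.
apply: (le_trans h1); rewrite -mulrA; apply: ler_pM => //.
  by apply: sumr_ge0.
by rewrite expr2 mulrCA ler_wpM2l.
Unshelve. all: by end_near. Qed.

(** The covector [<v, .>] frozen at [y0]: [lform c0] applied to a motion is a linear measure of
    displacement whose rate is close to the momentum, by [near_momentum_dist]. *)
Let c0 i := \sum_j B i j y0 * v y0 0 j.

Lemma near_momentum_dist (e : R) : 0 < e -> \forall y \near y0, forall w,
  `|lform c0 w - Bf y w (v y)| <= e * `|w|.
Proof.
move=> e0; pose c i y := \sum_j B i j y * v y 0 j.
have cc i : {for y0, continuous (c i)}.
  have H : Cr 0 A (c i).
    apply: (Cr_sum _ oA) => j _; apply: (Cr_mul oA).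
      exact: (Cr_le _ (cB i j)).
    exact: (Cr_coord j oA (Cr_le (leqnSn 0) cv)).
  exact: H.
have H := near_sum_dist cc e0; apply: filterS H => y Hy w.
have -> : lform c0 w - Bf y w (v y) = - lform (fun i => c i y - c i y0) w.
  rewrite /lform /bform -sumrB -sumrN; apply: eq_bigr => i _.
  rewrite mulrBl opprB; congr (_ - _).
  by rewrite mulr_suml; apply: eq_bigr => j _; rewrite -mulrA [X in _ * X]mulrC.
rewrite normrN; apply: le_trans (lform_norm _ _) _.
by rewrite ler_wpM2r.
Qed.

(** The distance [d] comes before [s]. If the motion stayed closer than [d], its momentum would
    remain at least [3 / 4] of [s * b0] up to time [T]; freezing the covector costs another quarter,
    so the displacement grows at rate at least [s * b0 / 2]. Over time [T] this gives
    [b0 ^+ 2 / (8 * C3)], where [s] has cancelled. *)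
Lemma mech_escape : exists2 d, 0 < d & forall (s : R) (y : R -> rV), 0 < s ->
  y 0 = y0 -> derive1 y 0 = s *: v y0 ->
  (forall t, 0 <= t -> [/\ A (y t), is_derive t (1:R) y (derive1 y t),
     exists w', is_derive t (1:R) (derive1 y) w' & EL_at L y t]) ->
  exists2 t, 0 <= t & d <= `|y t - y0|.
Proof.
have [c c_gt0 nc] := near_bform_coercive v0 (fun i j => Cr_le (isT : (0 <= 2)%N) (cB i j) _ Ay0) (fun w => @Bpos y0 w Ay0).
have [C C0 nC] := near_momentum_rate.
pose b0 := Bf y0 (v y0) (v y0).
have b0_gt0 : 0 < b0 by exact: Bpos.
(* An upper bound for the square root of [b0 / c], obtained without taking roots; energy
   conservation bounds the speed by [D * s]. *)
pose D := b0 / c + 1.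
have D0 : 0 < D by rewrite /D ltr_wpDl // divr_ge0 // ltW.
have DD : b0 / c <= D ^+ 2.
  have h : 0 <= b0 / c by rewrite divr_ge0 // ltW.
  rewrite /D sqrrD expr1n mulr1 -mulr_natr; have := sqr_ge0 (b0 / c); lra.
pose e := b0 / (4 * D).
have e0 : 0 < e by rewrite divr_gt0 // mulr_gt0.
have nl := near_momentum_dist e0.
have nA : \forall y \near y0, A y by exact: open_nbhs_nbhs.
have : \forall y \near y0, [/\ A y, forall w, c * `|w| ^+ 2 <= Bf y w w,
   forall w, `|'d (uncurried L) (y, w) (v y, 'd v y w)| <= C * `|w| ^+ 2 &
   forall w, `|lform c0 w - Bf y w (v y)| <= e * `|w|].
  by near=> y; split; near: y.
move=> /nbhs_ballP[r /= r0 Hr].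
(* Bounds the rate of the momentum by [C3 * s ^+ 2]; the 1 makes it positive, since [T] divides by
   it. *)
pose C3 := C * D ^+ 2 + 1.
have C30 : 0 < C3 by rewrite ltr_wpDl // mulr_ge0 // exprn_ge0 // ltW.
pose Lam := \sum_i `|c0 i| + 1.
have Lam0 : 0 < Lam by rewrite ltr_wpDl // sumr_ge0.
(* Chosen so that a motion closer than [d1] to [y0] has frozen displacement less than
   [b0 ^+ 2 / (8 * C3)], contradicting the lower bound at time [T]. *)
pose d1 := b0 ^+ 2 / (8 * C3) / Lam.
have d10 : 0 < d1 by rewrite !divr_gt0 ?exprn_gt0 // mulr_gt0.
exists (Num.min r d1); first by rewrite lt_min r0.
move=> s y s0 yy0 dy0 H; apply: contrapT => Hnot.
have close t : 0 <= t -> `|y t - y0| < Num.min r d1.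
  move=> t0; rewrite ltNge; apply/negP => h; apply: Hnot; exists t => //.
have loc t : 0 <= t -> [/\ A (y t), forall w, c * `|w| ^+ 2 <= Bf (y t) w w,
   forall w, `|'d (uncurried L) (y t, w) (v (y t), 'd v (y t) w)| <= C * `|w| ^+ 2 &
   forall w, `|lform c0 w - Bf (y t) w (v (y t))| <= e * `|w|].
  move=> t0; apply: Hr; rewrite -ball_normE /= distrC.
  by have := close t t0; rewrite lt_min => /andP[].
have energy t : 0 <= t ->
    2^-1 * Bf (y t) (derive1 y t) (derive1 y t) + u (y t) = 2^-1 * (s ^+ 2 * b0).
  move=> t0; have [x _ E] := @MVT_itv _ (fun s => 2^-1 * Bf (y s) (derive1 y s) (derive1 y s) + u (y s)) (fun=> 0) 0 t t0
    (fun x hx => let: And4 Ax dx (ex_intro w' dw) el := H x (proj1 (andP hx)) in mech_energy Ax dx dw el).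
  rewrite mul0r in E; have := subr0_eq E => ->.
  by rewrite yy0 dy0 u0 addr0 bformZ -expr2.
have Ds0 : 0 <= D * s by rewrite mulr_ge0 // ltW.
have speed t : 0 <= t -> `|derive1 y t| <= D * s.
  move=> t0; have [Ay hc _ _] := loc t t0.
  have h1 := hc (derive1 y t); have h2 := energy t t0; have h3 := u_ge0 Ay.
  have h4 : c * `|derive1 y t| ^+ 2 <= s ^+ 2 * b0 by lra.
  have h5 : `|derive1 y t| ^+ 2 <= (D * s) ^+ 2.
    rewrite exprMn; apply: (@le_trans _ _ (b0 / c * s ^+ 2)).
      by rewrite mulrAC ler_pdivlMr // mulrC [b0 * _]mulrC.
    by rewrite ler_wpM2r // exprn_ge0 // ltW.
  by move: h5; rewrite ler_sqr ?nnegrE.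
pose P t := Bf (y t) (derive1 y t) (v (y t)).
have dP (t : R) : 0 <= t -> is_derive t (1:R) P
    ('d (uncurried L) (y t, derive1 y t) (v (y t), 'd v (y t) (derive1 y t))).
  move=> t0; have [Ay dyt [w' dw] el] := H t t0.
  have nAt : \forall s \near t, A (y s).
    by apply: (is_derive_continuous dyt); exact: open_nbhs_nbhs.
  have nd : \forall s \near t, differentiable (uncurried L) (y s, derive1 y s).
    by apply: filterS nAt => x Ax; exact: (mech_differentiable oA cB cm cu).
  have M := EL_moving nd el (is_derive_curve dyt (dv Ay)).
  have nE : \forall x \near t, 'd (uncurried L) (y x, derive1 y x) (0, v (y x)) = P x.
    apply: filterS nAt => x Ax.
    have dLx := mech_differentiable oA cB cm cu (derive1 y x) Ax.
    apply: (etrans (esym (derive_snd (v (y x)) dLx))).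
    by rewrite (mech_derive_snd m u Bsym _ _ Ax) (m_v Ax) addr0.
  exact: (near_eq_is_derive nE M).
have dPb (t : R) : 0 <= t -> `|'d (uncurried L) (y t, derive1 y t) (v (y t), 'd v (y t) (derive1 y t))| <= C3 * s ^+ 2.
  move=> t0; have [_ _ hC _] := loc t t0; apply: (le_trans (hC _)).
  have h : `|derive1 y t| ^+ 2 <= (D * s) ^+ 2.
    by rewrite ler_sqr ?nnegrE //; exact: speed.
  have h' := ler_wpM2l C0 h; apply: (le_trans h').
  rewrite exprMn mulrA ler_wpM2r ?exprn_ge0 ?ltW // /C3 ltrDl //.
have P0 : P 0 = s * b0 by rewrite /P yy0 dy0 -[v y0 in X in bform _ _ X]scale1r bformZ mulr1.
(* The time in which a rate of [C3 * s ^+ 2] can consume a quarter of the initial momentum. *)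
pose T := b0 / (4 * C3 * s).
have T0 : 0 < T by rewrite divr_gt0 // !mulr_gt0.
have TC : C3 * s ^+ 2 * T = s * b0 / 4.
  rewrite /T; field; rewrite !gt_eqF //.
have Plow (t : R) : 0 <= t <= T -> s * b0 * (3 / 4) <= P t.
  move=> /andP[t0 tT].
  have : `|P t - P 0| <= C3 * s ^+ 2 * `|t - 0|.
    apply: (@MVT_dist _ P _ _ 0 t) => x; rewrite (min_idPl t0) => /andP[x0 _].
    by split; [exact: dP|exact: dPb].
  rewrite subr0 (ger0_norm t0) P0 => h.
  have h2 : C3 * s ^+ 2 * t <= C3 * s ^+ 2 * T.
    by rewrite ler_wpM2l // mulr_ge0 // ?exprn_ge0 // ltW.
  rewrite TC in h2; have := le_trans h h2; rewrite ler_norml => /andP[h3 _].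
  lra.
have elow (t : R) : 0 <= t <= T -> s * b0 / 2 <= lform c0 (derive1 y t).
  move=> tT; have /andP[t0 _] := tT; have h1 := Plow t tT.
  have [_ _ _ hl] := loc t t0; have h2 := hl (derive1 y t).
  have h3 := ler_wpM2l (ltW e0) (speed t t0).
  have h4 : e * (D * s) = s * b0 / 4 by rewrite /e; field; rewrite !gt_eqF //.
  rewrite h4 in h3; have := le_trans h2 h3; rewrite ler_norml => /andP[h5 _].
  rewrite -/(P t) in h5; lra.
have [x x0 E] := @MVT_itv _ (fun t => lform c0 (y t)) (fun t => lform c0 (derive1 y t)) 0 T (ltW T0)
    (fun x hx => let: And4 _ dx _ _ := H x (proj1 (andP hx)) in
      is_derive_bigsum (fun i => is_derive_eq (is_derive_mul (is_derive_cst (c0 i) x (1:R)) (is_derive_coord i dx)) (etrans (congr1 (fun z => z + _) (mul0r _)) (add0r _)))).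
rewrite subr0 in E.
have low : b0 ^+ 2 / (8 * C3) <= lform c0 (y T) - lform c0 (y 0).
  rewrite E (_ : b0 ^+ 2 / (8 * C3) = s * b0 / 2 * T); last first.
    by rewrite /T; field; rewrite !gt_eqF.
  by apply: ler_wpM2r; [exact: ltW|exact: elow].
have up : lform c0 (y T) - lform c0 (y 0) < Lam * d1.
  have -> : lform c0 (y T) - lform c0 (y 0) = lform c0 (y T - y0).
    by rewrite yy0 /lform -sumrB; apply: eq_bigr => i _; rewrite !mxE mulrBr.
  apply: le_lt_trans (ler_norm _) _; apply: le_lt_trans (lform_norm _ _) _.
  apply: (@le_lt_trans _ _ (Lam * `|y T - y0|)).
    by rewrite ler_wpM2r // /Lam lerDl.
  rewrite ltr_pM2l //.
  by have := close T (ltW T0); rewrite lt_min => /andP[].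
have : Lam * d1 = b0 ^+ 2 / (8 * C3) by rewrite /d1 mulrC divfK // gt_eqF.
lra.
Unshelve. all: by end_near. Qed.

End Escape.

(** * Changes of charts *)

Section Charts.
Context {R : realType} {n : nat} {N : manifold R n}.
Implicit Types c d e : chart R n N.

(** Stated on coordinates through [cinv], so that openness follows from continuity of [cinv];
    [overlapE] identifies it with the set of the atlas condition. *)
Definition overlap c d : set 'rV[R]_n := [set y | img c y /\ dom d (cinv c y)].

Definition transition c d : 'rV[R]_n -> 'rV[R]_n := cmap d \o cinv c.

Lemma cinv_dom c y : img c y -> dom c (cinv c y).
Proof. by move=> [x dx <-]; rewrite cmapK. Qed.

Lemma cinvK c y : img c y -> cmap c (cinv c y) = y.
Proof. by move=> [x dx <-]; rewrite cmapK. Qed.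

Lemma cmap_img c x : dom c x -> img c (cmap c x).
Proof. by move=> dx; exists x. Qed.

Lemma overlapE c d : overlap c d = cmap c @` (dom c `&` dom d).
Proof.
apply/seteqP; split=> y.
  by move=> [iy dy]; exists (cinv c y); rewrite ?cinvK //; split=> //; exact: cinv_dom.
by move=> [x [cx dx] <-]; split; [exact: cmap_img|rewrite cmapK].
Qed.

Lemma overlap_open c d : open (overlap c d).
Proof.
rewrite openE => y [iy dy]; rewrite /interior /=.
have h1 : \forall z \near y, img c z by apply: open_nbhs_nbhs; split => //; exact: img_open.
have h2 : \forall z \near y, dom d (cinv c z).
  by apply: (cinv_cont iy); apply: open_nbhs_nbhs; split => //; exact: dom_open.
by apply: filterS2 h1 h2 => z.
Qed.

Lemma transition_overlap c d y : overlap c d y -> overlap d c (transition c d y).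
Proof.
move=> [iy dy]; split; first exact: cmap_img.
by rewrite /transition /= cmapK //; exact: cinv_dom.
Qed.

Lemma transitionK c d y : overlap c d y -> transition d c (transition c d y) = y.
Proof. by move=> [iy dy]; rewrite /transition /= cmapK // cinvK. Qed.

Lemma transition_cinv c d y : overlap c d y -> cinv d (transition c d y) = cinv c y.
Proof. by move=> [iy dy]; rewrite /transition /= cmapK. Qed.

Lemma transition_Cr c d r : atlas c -> atlas d -> Cr r (overlap c d) (transition c d).
Proof. by move=> ac ad; rewrite overlapE; exact: atlas_compat. Qed.

Lemma transition_differentiable c d y : atlas c -> atlas d -> overlap c d y ->
  differentiable (transition c d) y.
Proof. by move=> ac ad oy; have [+ _] := transition_Cr 1 ac ad; exact. Qed.

(** Chain rule for a map on the manifold read in two charts. Taking [f] to be a third chart gives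
    the cocycle rule for transitions; taking [f := F] gives the change of chart for [F]. *)
Lemma diff_transition (W : normedModType R) (f : N -> W) c d y w :
  atlas c -> atlas d -> overlap c d y ->
  differentiable (f \o cinv d) (transition c d y) ->
  'd (f \o cinv c) y w = 'd (f \o cinv d) (transition c d y) ('d (transition c d) y w).
Proof.
move=> ac ad oy df; have dt := transition_differentiable ac ad oy.
have nE : {near y, (f \o cinv d) \o transition c d =1 f \o cinv c}.
  have : \forall z \near y, overlap c d z by apply: open_nbhs_nbhs; split => //; exact: overlap_open.
  by apply: filterS => z /transition_cinv /= ->.
have [_ E] := near_eq_is_diff nE (differentiable_comp dt df).
apply: (etrans (congr1 (@^~ w) E)).
exact: (congr1 (@^~ w) (diff_comp dt df)).
Qed.

Lemma overlap_chart_at c y : img c y -> overlap c (chart_at (cinv c y)) y.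
Proof. by move=> iy; split => //; exact: chart_at_dom. Qed.

Lemma from_chart_transition c d y w : atlas c -> atlas d -> overlap c d y ->
  from_chart d (transition c d y) ('d (transition c d) y w) = from_chart c y w.
Proof.
move=> ac ad oy; rewrite /from_chart transition_cinv //.
set e := chart_at _; have ae : atlas e by exact: chart_at_atlas.
apply: esym; apply: diff_transition => //.
apply: (@transition_differentiable d e) => //.
split; first by case: (transition_overlap oy).
by rewrite transition_cinv //; exact: chart_at_dom.
Qed.

Lemma TNinv_transition c d y w : atlas c -> atlas d -> overlap c d y ->
  TNinv d (transition c d y, 'd (transition c d) y w) = TNinv c (y, w).
Proof.
by move=> ac ad oy; rewrite /TNinv /= transition_cinv // from_chart_transition.
Qed.

Lemma diff_transition_self c y w : img c y -> 'd (transition c c) y w = w.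
Proof.
move=> iy; have nE : {near y, id =1 transition c c}.
  have : \forall z \near y, img c z by apply: open_nbhs_nbhs; split => //; exact: img_open.
  by apply: filterS => z /cinvK.
have [_ E] := near_eq_is_diff nE (@ex_diff _ _ _ _ _ _ _ (is_diff_id y)).
apply: (etrans (congr1 (@^~ w) E)).
by have [_ E2] := is_diff_id y; exact: (congr1 (@^~ w) E2).
Qed.

Lemma from_chart_at (x : N) w : from_chart (chart_at x) (cmap (chart_at x) x) w = w.
Proof.
have dx := chart_at_dom x.
rewrite /from_chart cmapK //; apply: diff_transition_self; exact: cmap_img.
Qed.

(** The identity of chart [c] factors through the transition to [chart_at] and back, so the
    derivative of the first transition is injective. *)
Lemma from_chart_inj0 c y w : atlas c -> img c y -> from_chart c y w = 0 -> w = 0.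
Proof.
move=> ac iy; pose e := chart_at (cinv c y).
have ae : atlas e by exact: chart_at_atlas.
have oy : overlap c e y by exact: overlap_chart_at.
rewrite -[from_chart c y w]/('d (transition c e) y w) => h.
have E := @diff_transition _ (cmap c) c e y w ac ae oy
  (transition_differentiable ae ac (transition_overlap oy)).
have E2 := diff_transition_self w iy.
apply: (etrans (esym E2)); apply: (etrans E).
have Z : 'd (transition e c) (transition c e y) 0 = 0 by exact: linear0.
exact: (etrans (congr1 ('d (transition e c) (transition c e y)) h) Z).
Qed.

(** [tdiff] is defined in the chosen chart of each point, which varies with the point; this makes it
    computable in one fixed chart. *)
Lemma tdiff_from_chart (W : normedModType R) (f : N -> W) c y w : CrM 1 f ->
  atlas c -> img c y ->
  tdiff f (cinv c y) (from_chart c y w) = 'd (f \o cinv c) y w.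
Proof.
move=> cf ac iy; rewrite /tdiff; set e := chart_at _.
have ae : atlas e by exact: chart_at_atlas.
have oy : overlap c e y by exact: overlap_chart_at.
apply: esym; apply: (@diff_transition _ f c e y w) => //.
have [+ _] := cf e ae; apply.
by case: (transition_overlap oy).
Qed.

Lemma local_lagrangian_transition (L : N -> 'rV[R]_n -> R) c d y w :
  atlas c -> atlas d -> overlap c d y ->
  local_lagrangian L c y w =
  local_lagrangian L d (transition c d y) ('d (transition c d) y w).
Proof. by move=> ac ad oy; rewrite /local_lagrangian TNinv_transition. Qed.

End Charts.

(** * Restriction to fixed vectors and polarization in coordinates *)

Section QuadraticForms.
Context {R : realType}.

Lemma Cr_slice (V W U : normedModType R) r (A : set V) (f : V * W -> U) w :
  open A -> Cr r [set q : (V * W)%type | A q.1] f -> Cr r A (fun y => f (y, w)).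
Proof.
move=> oA; elim: r f => [|r IH] f.
  move=> cf y Ay; apply: (@continuous_comp _ _ _ (fun y => (y, w)) f); last exact: cf.
  by apply: cvg_pair; [exact: cvg_id|exact: cvg_cst].
move=> [df dfr]; split=> [y Ay|v].
  by have [d1 _ _ _ _] := diff_fst_snd 0 0 (df (y, w) Ay).
apply: (Cr_eq oA _ (IH _ (dfr (v, 0)))) => y Ay.
by have [_ _ E _ _] := diff_fst_snd v 0 (df (y, w) Ay).
Qed.

Lemma scalar_rVE n (f : 'rV[R]_n -> R) w : scalar f ->
  f w = \sum_i w 0 i * f (delta_mx 0 i).
Proof.
move=> sf.
pose fM := GRing.isLinear.Build _ _ _ _ f sf.
pose fL : {scalar 'rV[R]_n} := HB.pack f fM.
rewrite -[f]/(fL : _ -> _) {1}[w]row_sum_delta linear_sum.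
by apply: eq_bigr => i _; rewrite linearZ.
Qed.

(** Homogeneity gives [q (w + w) = 4 * q w], hence [polar q w w = 2 * q w]; the polar form is then
    expanded in the basis. *)
Lemma quadratic_form_bform n (q : 'rV[R]_n -> R) w : quadratic_form q ->
  q w = 2^-1 * bform (fun i j => polar q (delta_mx 0 i) (delta_mx 0 j)) w w.
Proof.
move=> [qZ pl].
have pC v1 v2 : polar q v1 v2 = polar q v2 v1.
  by rewrite /polar addrC addrAC [v2 + v1]addrC; ring.
have -> : q w = 2^-1 * polar q w w.
  have w2 : w + w = (2 : R) *: w by rewrite scaler_nat mulr2n.
  rewrite /polar w2 qZ expr2; lra.
congr (_ * _); rewrite (scalar_rVE w (pl w)) /bform exchange_big /=.
apply: eq_bigr => j _; rewrite pC (scalar_rVE w (pl _)) mulr_sumr.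
by apply: eq_bigr => i _; rewrite [polar q (delta_mx 0 j) _]pC; ring.
Qed.

End QuadraticForms.

(** * Pullbacks of one-forms *)

Section Pullback.
Context {R : realType} {n k : nat}.
Local Notation rVn := 'rV[R]_n.
Local Notation rVk := 'rV[R]_k.
Variables (A : set rVn) (G : rVn -> rVk) (omega : rVk -> rVk -> R).
Hypothesis oA : open A.
Hypothesis cG : Cr 3 A G.
Hypothesis somega : smooth_one_form omega.

Definition pullback_coef (i : 'I_n) (y : rVn) : R :=
  omega (G y) ('d G y (delta_mx 0 i)).

Let dG y : A y -> differentiable G y.
Proof. by move=> Ay; have [+ _] := cG; exact. Qed.

Let domega z v : differentiable (omega ^~ v : rVk -> R) z.
Proof. by have [_ /(_ v 1)[+ _]] := somega; exact. Qed.

Let cdG v : Cr 2 A (fun y => 'd G y v).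
Proof. by case: cG => _ /(_ v). Qed.

Lemma omega_sum z w : omega z w = \sum_j w 0 j * omega z (delta_mx 0 j).
Proof. by have [so _] := somega; exact: scalar_rVE. Qed.

Lemma pullback_lform y w : omega (G y) ('d G y w) = lform (pullback_coef ^~ y) w.
Proof.
rewrite /lform /pullback_coef.
have E := diff_rVE G y w.
apply: (etrans (congr1 (omega (G y)) E)).
have [so _] := somega.
pose fM := GRing.isLinear.Build _ _ _ _ (omega (G y)) (so (G y)).
pose fL : {scalar rVk} := HB.pack (omega (G y)) fM.
rewrite -[omega (G y)]/(fL : _ -> _) linear_sum; apply: eq_bigr => i _.
by rewrite linearZ /= mulrC.
Qed.

Lemma pullback_coef_Cr i : Cr 2 A (pullback_coef i).
Proof.
apply: (@Cr_ext _ _ _ _ _ (fun y => \sum_j 'd G y (delta_mx 0 i) 0 j * omega (G y) (delta_mx 0 j))).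
  by move=> y; exact: omega_sum.
apply: (Cr_sum _ oA) => j _; apply: (Cr_mul oA (Cr_coord j oA (cdG _))).
have [_ so] := somega.
exact: (Cr_comp oA (fun y _ => I : setT (G y)) (Cr_le (leqnSn 2) cG) (so (delta_mx 0 j) 2)).
Qed.

(** [omega] is known to be smooth only with its vector argument fixed, so it is expanded in the
    basis before the product rule is applied, and the sum is folded back by linearity. *)
Lemma pullback_derive y a b : A y ->
  is_derive y a (fun z => omega (G z) ('d G z b))
    (omega (G y) ('d (fun z => 'd G z b) y a) +
     'd (omega ^~ ('d G y b) : rVk -> R) (G y) ('d G y a)).
Proof.
move=> Ay.
pose w j := omega ^~ (delta_mx 0 j : rVk) : rVk -> R.
have d2G : differentiable (fun z => 'd G z b) y by have [+ _] := cdG b; exact.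
have d1 j : is_derive y a (fun z => 'd G z b 0 j) ('d (fun z => 'd G z b) y a 0 j).
  have [dc dE] := is_diff_coord j d2G.
  by apply: is_derive_eq (is_derive_diff a dc) _; rewrite dE.
have d2 j : is_derive y a (fun z => w j (G z)) ('d (w j) (G y) ('d G y a)).
  have dw : differentiable (w j) (G y) by exact: domega.
  apply: is_derive_eq (is_derive_diff a (differentiable_comp (dG Ay) dw)) _.
  exact: (congr1 (@^~ a) (diff_comp (dG Ay) dw)).
have H := is_derive_bigsum (fun j => is_derive_mul (d1 j) (d2 j)).
have FE : (fun z => omega (G z) ('d G z b)) = fun z => \sum_j 'd G z b 0 j * w j (G z).
  by apply/funext => z; exact: omega_sum.
rewrite FE; apply: is_derive_eq H _; rewrite big_split; congr (_ + _).
  by rewrite [RHS]omega_sum.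
set beta := 'd G y b; set alpha := 'd G y a.
have K : is_derive (G y) alpha (fun z => \sum_j w j z * beta 0 j)
    (\sum_j ('d (w j) (G y) alpha * beta 0 j + w j (G y) * 0)).
  apply: is_derive_bigsum => j.
  exact: (is_derive_mul (is_derive_diff alpha (domega _ _)) (is_derive_cst (beta 0 j) (G y) alpha)).
have e1 := @derive_val _ _ _ _ _ _ _ K.
have WE : (omega ^~ beta : rVk -> R) = fun z => \sum_j w j z * beta 0 j.
  apply/funext => z; rewrite [LHS]omega_sum; apply: eq_bigr => j _; exact: mulrC.
have e2 := deriveE alpha (@domega (G y) beta).
apply: esym; apply: (etrans (esym e2)).
rewrite WE; apply: (etrans e1); apply: eq_bigr => j _.
by rewrite mulr0 addr0 mulrC.
Qed.

(** Antisymmetrization cancels the terms in which the derivative falls on ['d G]; those in which it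
    falls on [omega] remain. *)
Lemma pullback_diff_bracket y a b : A y ->
  'D_a (fun z => omega (G z) ('d G z b)) y - 'D_b (fun z => omega (G z) ('d G z a)) y =
  ext_deriv_Rk omega (G y) ('d G y a) ('d G y b).
Proof.
move=> Ay.
have e1 := @derive_val _ _ _ _ _ _ _ (pullback_derive a b Ay).
have e2 := @derive_val _ _ _ _ _ _ _ (pullback_derive b a Ay).
apply: (etrans (f_equal2 (fun p q => p - q) e1 e2)).
have S := schwarz b a oA Ay (Cr_le (leqnSn 2) cG).
have S' := congr1 (omega (G y)) S.
rewrite /ext_deriv_Rk; move: S'.
set p := omega _ _; set q := omega _ _ => ->.
by rewrite opprD addrACA subrr add0r.
Qed.

Lemma pullback_differentiable y b : A y ->
  differentiable (fun z => omega (G z) ('d G z b)) y.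
Proof.
move=> Ay; rewrite (_ : (fun z => _) = fun z => lform (pullback_coef ^~ z) b).
  have H : Cr 2 A (fun z => lform (pullback_coef ^~ z) b).
    by apply: (Cr_sum _ oA) => i _; apply: (Cr_mul oA (pullback_coef_Cr i) (Cr_cst _ _ _)).
  by have [+ _] := H; exact.
by apply/funext => z; exact: pullback_lform.
Qed.

(** The left-hand side is the exterior derivative of the one-form with coefficients [pullback_coef].
    When ['d G y] kills [a] the right-hand side vanishes, which supplies the hypothesis [dm_v] of
    the escape estimate. *)
Lemma pullback_closed y a b : A y ->
  lform (fun i => 'd (pullback_coef i) y a) b -
  lform (fun i => 'd (pullback_coef i) y b) a =
  ext_deriv_Rk omega (G y) ('d G y a) ('d G y b).
Proof.
move=> Ay.
have E p q : lform (fun i => 'd (pullback_coef i) y p) q = 'D_p (fun z => omega (G z) ('d G z q)) y.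
  have H : is_derive y p (fun z => \sum_i pullback_coef i z * q 0 i)
      (\sum_i ('d (pullback_coef i) y p * q 0 i + pullback_coef i y * 0)).
    apply: is_derive_bigsum => i.
    have dc : differentiable (pullback_coef i) y by have [+ _] := pullback_coef_Cr i; exact.
    exact: (is_derive_mul (is_derive_diff p dc) (is_derive_cst (q 0 i) y p)).
  have e1 := @derive_val _ _ _ _ _ _ _ H.
  have FE : (fun z => omega (G z) ('d G z q)) = fun z => \sum_i pullback_coef i z * q 0 i.
    by apply/funext => z; exact: pullback_lform.
  rewrite FE; apply: esym; apply: (etrans e1).
  by apply: eq_bigr => i _; rewrite mulr0 addr0.
by rewrite !E; exact: pullback_diff_bracket.
Qed.

Lemma ext_deriv_Rk0l z b : ext_deriv_Rk omega z 0 b = 0.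
Proof.
have [so _] := somega.
have o0 : (omega ^~ 0 : rVk -> R) = cst 0.
  by apply/funext => x; rewrite omega_sum big1 // => j _; rewrite mxE mul0r.
rewrite /ext_deriv_Rk linear0 o0 sub0r; apply/eqP; rewrite oppr_eq0; apply/eqP.
exact: (congr1 (@^~ b) (diff_cst (0 : R) z)).
Qed.

End Pullback.

(** * A nonvanishing field tangent to the level sets *)

Section KernelField.
Context {R : realType} {n k : nat}.
Local Notation rVn := 'rV[R]_n.
Local Notation rVk := 'rV[R]_k.

(* With S a right inverse of the Jacobian J at y0, the adjugate of S J gives a
   division-free projection onto ker J that is the identity on u0 at y0. *)
Lemma kernel_field (A : set rVn) (G : rVn -> rVk) y0 : open A -> A y0 ->
  Cr 2 A G -> (k < n)%N -> (forall z, exists w, 'd G y0 w = z) ->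
  exists v : rVn -> rVn, [/\ Cr 1 A v, v y0 != 0 &
    forall y, A y -> 'd G y (v y) = 0].
Proof.
move=> oA Ay0 cG2 kn surj.
have cG v : Cr 1 A (fun y => 'd G y v) by case: cG2 => _ /(_ v).
pose J y : 'M[R]_(n, k) := \matrix_(i, j) 'd G y (delta_mx 0 i) 0 j.
have JE y w : 'd G y w = w *m J y.
  apply/rowP => j; have E := congr1 (fun z : rVk => z 0 j) (diff_rVE G y w).
  apply: (etrans E); rewrite summxE mxE; apply: eq_bigr => i _.
  by rewrite [LHS]mxE [X in _ = _ * X]mxE.
have /choice[s Hs] : forall j, exists w, 'd G y0 w = delta_mx 0 j by move=> j; exact: surj.
pose S : 'M[R]_(k, n) := \matrix_(j, i) s j 0 i.
have SJ : S *m J y0 = 1%:M.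
  apply/row_matrixP => j; rewrite row_mul.
  have -> : row j S = s j by apply/rowP => i; rewrite !mxE.
  by rewrite -JE Hs row1.
(* The Jacobian acts on row vectors from the right and has rank at most [k < n], so some nonzero row
   vector is killed. *)
have [u0 u00 u0J] : exists2 u0 : rVn, u0 != 0 & u0 *m J y0 = 0.
  have : kermx (J y0) != 0.
    rewrite -mxrank_eq0 mxrank_ker subn_eq0 -ltnNge.
    exact: leq_ltn_trans (rank_leq_col _) kn.
  by case/rowV0Pn => w /sub_kermxP wJ w0; exists w.
pose C y := S *m J y.
exists (fun y => \det (C y) *: u0 - u0 *m J y *m \adj (C y) *m S); split.
- have cJ i j : Cr 1 A (fun y => J y i j).
    apply: (@Cr_ext _ _ _ _ _ (fun y => 'd G y (delta_mx 0 i) 0 j)); first by move=> y; rewrite mxE.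
    exact: (Cr_coord j oA (cG _)).
  have cC i j : Cr 1 A (fun y => C y i j).
    apply: (@Cr_ext _ _ _ _ _ (fun y => \sum_l S i l * J y l j)); first by move=> y; rewrite mxE.
    by apply: (Cr_sum _ oA) => l _; exact: (Cr_mul oA (Cr_cst _ _ _) (cJ l j)).
  apply: (Cr_rV oA) => i.
  apply: (@Cr_ext _ _ _ _ _ (fun y => \det (C y) * u0 0 i -
     \sum_a (\sum_b (\sum_c u0 0 c * J y c b) * \adj (C y) b a) * S a i)).
    move=> y; rewrite !mxE; congr (_ - _).
    apply: eq_bigr => a _; congr (_ * _); rewrite [LHS]mxE.
    apply: eq_bigr => b _; congr (_ * _).
    by rewrite [LHS]mxE.
  apply: (CrB oA); first exact: (Cr_mul oA (Cr_det oA cC) (Cr_cst _ _ _)).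
  apply: (Cr_sum _ oA) => a _; apply: (Cr_mul oA _ (Cr_cst _ _ _)).
  apply: (Cr_sum _ oA) => b _; apply: (Cr_mul oA _ (Cr_adj _ _ oA cC)).
  by apply: (Cr_sum _ oA) => c _; exact: (Cr_mul oA (Cr_cst _ _ _) (cJ c b)).
- by rewrite /C SJ det1 scale1r u0J !mul0mx subr0.
move=> y Ay; rewrite JE mulmxBl -scalemxAl -!mulmxA -/(C y) mul_adj_mx.
by rewrite mul_mx_scalar -scalemxAr subrr.
Qed.

End KernelField.

(** * Maximal solutions *)

Section Solutions.
Context {R : realType} {n : nat} {N : manifold R n}.
Variable L : N -> 'rV[R]_n -> R.

(** Both sides of the equation depend only on the germ of the curve at [t] and on the Lagrangian
    over a neighbourhood of its position. Since velocities at nearby times matter too, equality of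
    the curves is needed around each of these times. *)
Lemma EL_at_near (l1 l2 : 'rV[R]_n -> 'rV[R]_n -> R) (A : set 'rV[R]_n)
    (y1 y2 : R -> 'rV[R]_n) (t : R) : open A -> A (y1 t) -> {for t, continuous y1} ->
  (forall x w, A x -> l1 x w = l2 x w) ->
  (\forall s \near t, y1 s = y2 s) -> EL_at l1 y1 t -> EL_at l2 y2 t.
Proof.
move=> oA Ay cy l12 y12 el v.
have nA : \forall s \near t, A (y1 s) by apply: cy; exact: open_nbhs_nbhs.
have y12' : \forall s \near t, \forall r \near s, y1 r = y2 r by exact: near_join.
have dE s : (\forall r \near s, y1 r = y2 r) -> derive1 y1 s = derive1 y2 s.
  by move=> h; rewrite !derive1E; exact: near_eq_derive.
have tE := nbhs_singleton y12; have dtE := dE t y12.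
have nl : \forall z \near y1 t, l1 z (derive1 y1 t) = l2 z (derive1 y1 t).
  have : \forall z \near y1 t, A z by exact: open_nbhs_nbhs.
  by apply: filterS => z; exact: l12.
have E : 'D_v (fun z => l1 z (derive1 y1 t)) (y1 t) =
    'D_v (fun z => l2 z (derive1 y2 t)) (y2 t).
  by rewrite (near_eq_derive v nl) dtE tE.
rewrite -E; apply: near_eq_is_derive (el v).
apply: filterS3 nA y12 y12' => s As sE /dE dsE.
rewrite -dsE -sE; congr (derive _ _ _).
by apply/funext => w; exact: l12.
Qed.

Lemma EL_domain_open (I : set R) (gamma : R -> N) (c : chart R n N) :
  open I -> EL_solution L I gamma -> open [set t | I t /\ dom c (gamma t)].
Proof.
move=> oI [cg _]; rewrite openE => t [It dt]; rewrite /interior /=.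
have h1 : \forall s \near t, I s by exact: open_nbhs_nbhs.
have h2 : \forall s \near t, dom c (gamma s).
  by apply: (cg t It); apply: open_nbhs_nbhs; split => //; exact: dom_open.
exact: filterS2 h1 h2.
Qed.

(** Being a solution is local in time; this is what lets solutions be glued along a chain in the
    maximality argument. *)
Lemma EL_local (I : set R) (gamma : R -> N) :
  (forall t, I t -> exists J eta, [/\ open J, J t, J `<=` I, EL_solution L J eta &
     forall s, J s -> eta s = gamma s]) ->
  EL_solution L I gamma.
Proof.
move=> H; split=> [t /H[J [eta [oJ Jt JI [ce _] E]]]|c ac].
  rewrite /prop_for /continuous_at -(E t Jt); apply: cvg_trans (ce t Jt).
  apply: near_eq_cvg; have : \forall s \near t, J s by exact: open_nbhs_nbhs.
  by apply: filterS.
split.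
  apply: Cr_local => t [It dt]; have [J [eta [oJ Jt JI el E]]] := H t It.
  exists [set s | J s /\ dom c (gamma s)] => //.
  have E1 : [set s | J s /\ dom c (gamma s)] = [set s | J s /\ dom c (eta s)].
    by apply/seteqP; split=> s [Js ds]; split=> //; move: ds; rewrite (E s Js).
  rewrite E1; have oJ' := EL_domain_open (c := c) oJ el.
  have [_ /(_ c ac)[ce _]] := el.
  by apply: (Cr_eq oJ' _ ce) => s [Js _] /=; rewrite E.
move=> t [It dt]; have [J [eta [oJ Jt JI el E]]] := H t It.
have dt' : dom c (eta t) by rewrite E.
have [ce /(_ c ac)[cy /(_ t (conj Jt dt')) el']] := el.
have cyt : {for t, continuous (cmap c \o eta)}.
  by have := Cr_le (isT : (0 <= 2)%N) cy; apply; split.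
have nE : \forall s \near t, (cmap c \o eta) s = (cmap c \o gamma) s.
  have : \forall s \near t, J s by exact: open_nbhs_nbhs.
  by apply: filterS => s Js /=; rewrite E.
exact: (EL_at_near openT Logic.I cyt (fun x w _ => erefl) nE el').
Qed.

(** Zorn's lemma on the solutions extending [gamma0], ordered by extension. Members of a chain agree
    wherever two of them are defined, so they glue to a solution on the union of their intervals. *)
Lemma maximal_extension (I0 : set R) (gamma0 : R -> N) :
  open I0 -> is_interval I0 -> I0 0 -> EL_solution L I0 gamma0 ->
  exists I gamma, [/\ maximal_EL_solution L I gamma, I0 `<=` I &
    forall t, I0 t -> gamma t = gamma0 t].
Proof.
move=> oI0 iI0 I00 el0.
pose P (p : set R * (R -> N)) := [/\ open p.1, is_interval p.1, EL_solution L p.1 p.2,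
  I0 `<=` p.1 & forall t, I0 t -> p.2 t = gamma0 t].
pose T := {p | P p}.
pose ext (p q : T) := (sval p).1 `<=` (sval q).1 /\
  forall t, (sval p).1 t -> (sval q).2 t = (sval p).2 t.
(* Only a preorder: curves are total functions, and two of them may differ off their common
   interval. *)
pose rel (p q : T) := `[< ext p q >].
have P0 : P (I0, gamma0) by split.
have rel_refl p : rel p p by apply/asboolP; split.
have rel_trans p q r : rel p q -> rel q r -> rel p r.
  move=> /asboolP[pq1 pq2] /asboolP[qr1 qr2]; apply/asboolP; split.
    exact: subset_trans pq1 qr1.
  by move=> t pt; rewrite qr2 ?pq2 //; exact: pq1.
have chain (C : set T) : total_on C (fun x y => rel x y) ->
    exists q, forall p, C p -> rel p q.
  move=> Ctot; have [[p0 Cp0]|Cempty] := pselect (exists p, C p); last first.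
    by exists (exist _ _ P0) => p Cp; exfalso; apply: Cempty; exists p.
  pose I := [set t | exists p, C p /\ (sval p).1 t].
  have /choice[gam Hgam] : forall t, exists x : N, forall p, C p -> (sval p).1 t -> (sval p).2 t = x.
    move=> t; have [[p [Cp pt]]|nI] := pselect (I t); last first.
      by exists (gamma0 0) => p Cp pt; exfalso; apply: nI; exists p.
    exists ((sval p).2 t) => q Cq qt.
    by have [/asboolP[_ ->]|/asboolP[_ ->]] := Ctot _ _ Cp Cq.
  have PI : P (I, gam).
    split => /=.
    - rewrite openE => t [p [Cp pt]]; have [op _ _ _ _] := svalP p.
      have : \forall s \near t, (sval p).1 s by exact: open_nbhs_nbhs.
      by apply: filterS => s ps; exists p.
    - move=> x y [p [Cp px]] [q [Cq qy]] z xzy.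
      have [/asboolP[pq _]|/asboolP[qp _]] := Ctot _ _ Cp Cq.
        have [_ iq _ _ _] := svalP q; exists q; split => //.
        exact: (iq x y (pq _ px) qy).
      have [_ ip _ _ _] := svalP p; exists p; split => //.
      exact: (ip x y px (qp _ qy)).
    - apply: EL_local => t [p [Cp pt]]; have [op _ elp _ _] := svalP p.
      exists (sval p).1, (sval p).2; split => //; first by move=> s ps; exists p.
      by move=> s ps; apply: Hgam.
    - by move=> t I0t; exists p0; split => //; have [_ _ _ + _] := svalP p0; apply.
    move=> t I0t; have [_ _ _ sub E] := svalP p0.
    by rewrite -(Hgam t p0 Cp0 (sub t I0t)); exact: E.
  exists (exist _ _ PI) => p Cp; apply/asboolP; split => [t pt|t pt] /=.
    by exists p.
  by apply: esym; exact: Hgam.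
have [[[I gam] PI] pmax] := ZL_preorder (exist _ _ P0 : T) rel_refl rel_trans chain.
have [/= oI iI elI sub E] := PI.
exists I, gam; split => //; split => //; first exact: sub.
move=> J eta oJ iJ IJ elJ Eeta.
have PJ : P (J, eta).
  split => //=; first exact: subset_trans sub IJ.
  by move=> t I0t; rewrite Eeta ?E //; exact: sub.
have IJrel : rel (exist _ _ PI) (exist _ _ PJ) by apply/asboolP; split.
by have /asboolP[] := pmax _ IJrel.
Qed.

(** The definition asks for the equations in every chart, and [EL_change] on the overlaps transfers
    them from [c0]. *)
Lemma chart_EL_solution (c0 : chart R n N) (l0 : 'rV[R]_n -> 'rV[R]_n -> R)
    (T : R) (y : R -> 'rV[R]_n) : atlas c0 ->
  (forall x w, img c0 x -> l0 x w = local_lagrangian L c0 x w) ->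
  (forall c z w, atlas c -> img c z ->
     differentiable (uncurried (local_lagrangian L c)) (z, w)) ->
  Cr 2 [set t | `|t| < T] y ->
  (forall t, `|t| < T -> [/\ img c0 (y t), is_derive t (1:R) y (derive1 y t),
     exists y2, is_derive t (1:R) (derive1 y) y2 & EL_at l0 y t]) ->
  EL_solution L [set t | `|t| < T] (cinv c0 \o y).
Proof.
move=> ac0 l0E dL cy Hy.
have oI : open [set t : R | `|t| < T].
  rewrite (_ : [set t | _] = ball (0:R) T) //; first exact: ball_open.
  by apply/seteqP; split=> s /=; rewrite -ball_normE /= sub0r normrN.
have cg t : `|t| < T -> {for t, continuous (cinv c0 \o y)}.
  move=> tT; have [iy dy _ _] := Hy t tT.
  apply: continuous_comp; first exact: is_derive_continuous dy.
  exact: cinv_cont.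
split => // c ac.
have oJ : open [set t | `|t| < T /\ dom c (cinv c0 (y t))].
  rewrite openE => t [It dt]; rewrite /interior /=.
  have h1 : \forall s \near t, `|s| < T by exact: open_nbhs_nbhs.
  have h2 : \forall s \near t, dom c (cinv c0 (y s)).
    by apply: (cg t It); apply: open_nbhs_nbhs; split => //; exact: dom_open.
  exact: filterS2 h1 h2.
have JO t : `|t| < T /\ dom c (cinv c0 (y t)) -> overlap c0 c (y t).
  by move=> [tT dt]; split => //; case: (Hy t tT).
split.
  apply: (Cr_rV oJ) => i.
  have H := Cr_comp oJ JO (Cr_sub _ cy) (Cr_coord i (@overlap_open _ _ _ c0 c) (transition_Cr 2 ac0 ac)).
  by apply: H => t [].
move=> t Jt; have [tT dt] := Jt; have [iy dy [y2 d2y] el] := Hy t tT.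
apply: (@EL_change R n (local_lagrangian L c) l0 (overlap c0 c) (overlap c c0)
  (transition c0 c) (transition c c0) y t y2) => //.
- exact: overlap_open.
- exact: overlap_open.
- exact: transition_Cr.
- exact: transition_Cr.
- exact: transition_overlap.
- exact: transition_overlap.
- exact: transitionK.
- exact: transitionK.
- by move=> x w ox; rewrite l0E; [exact: local_lagrangian_transition|case: ox].
- by move=> z w [iz _]; exact: dL.
have : \forall s \near t, `|s| < T by exact: open_nbhs_nbhs.
by apply: filterS => s /Hy[].
Qed.

Lemma EL_chart_derive (I : set R) (gamma : R -> N) c t : open I ->
  EL_solution L I gamma -> atlas c -> I t -> dom c (gamma t) ->
  let y := cmap c \o gamma : R -> 'rV[R]_n in
  [/\ is_derive t (1:R) y (derive1 y t), exists y2, is_derive t (1:R) (derive1 y) y2 &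
    EL_at (local_lagrangian L c) y t].
Proof.
move=> oI el ac It dt y; have oJ := EL_domain_open (c := c) oI el.
have [_ /(_ c ac)[[dy /(_ 1)[d2y _]] elc]] := el.
have dE s : I s /\ dom c (gamma s) -> 'd y s 1 = derive1 y s.
  by move=> Js; rewrite derive1E' //; exact: dy.
have dd : differentiable (fun s => 'd y s 1) t by exact: d2y.
split.
- have := is_derive_diff (1:R) (dy t (conj It dt)) => /is_derive_eq; apply.
  exact: dE.
- exists ('d (fun s => 'd y s 1) t (1:R)).
  apply: near_eq_is_derive (is_derive_diff (1:R) dd).
  have : \forall s \near t, I s /\ dom c (gamma s) by apply: open_nbhs_nbhs; split.
  by apply: filterS => s; exact: dE.
by apply: elc; split.
Qed.

End Solutions.

(** * The Lagrangian in charts *)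

Section LagrangianInCharts.
Context {R : realType} {n k : nat} {N : manifold R n}.
Variables (Q : N -> 'rV[R]_n -> R) (g : 'rV[R]_k -> R) (F : N -> 'rV[R]_k).
Variable omega : 'rV[R]_k -> 'rV[R]_k -> R.
Hypothesis Q_posdef : posdef_quadratic_on_TN Q.
Hypothesis Q_C2 : CrTN 2 Q.
Hypothesis g_C2 : Cr 2 setT g.
Hypothesis F_C3 : CrM 3 F.
Hypothesis somega : smooth_one_form omega.
Implicit Type c : chart R n N.

Definition chart_metric c (i j : 'I_n) (y : 'rV[R]_n) : R :=
  polar (fun w => Q (cinv c y) (from_chart c y w)) (delta_mx 0 i) (delta_mx 0 j).

Definition chart_map c : 'rV[R]_n -> 'rV[R]_k := F \o cinv c.

Definition chart_potential c (y : 'rV[R]_n) : R := g (chart_map c y).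

(** Convertible to the Lagrangian of the theorem at the pullback of [omega], so results about it
    apply there directly. *)
Definition magnetic_lagrangian : N -> 'rV[R]_n -> R :=
  fun x v => Q x v + pullback F omega x v - g (F x).

Definition chart_lagrangian c := mech (chart_metric c)
  (pullback_coef (chart_map c) omega) (chart_potential c).

Lemma chart_metric_sym c i j y : chart_metric c i j y = chart_metric c j i y.
Proof. by rewrite /chart_metric /polar addrAC addrC addrAC [delta_mx 0 i + _]addrC; ring. Qed.

Lemma chart_metricE c y w : Q (cinv c y) (from_chart c y w) =
  2^-1 * bform (fun i j => chart_metric c i j y) w w.
Proof.
have [qf _] := Q_posdef (cinv c y).
apply: (quadratic_form_bform (q := fun w => Q (cinv c y) (from_chart c y w))).
have fD u v : from_chart c y (u + v) = from_chart c y u + from_chart c y v.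
  exact: linearD.
have fZ a v : from_chart c y (a *: v) = a *: from_chart c y v by exact: linearZ.
split=> [a v|v a u1 u2]; first by rewrite fZ; case: qf.
rewrite /polar !fD fZ; have [_ /(_ (from_chart c y v) a (from_chart c y u1) (from_chart c y u2))] := qf.
by rewrite /polar.
Qed.

(** Polarization expresses each coefficient by three values of [Q] at fixed vectors, that is by
    slices of a function of class [C^2] on the tangent bundle. *)
Lemma chart_metric_Cr c i j : atlas c -> Cr 2 (img c) (chart_metric c i j).
Proof.
move=> ac; have oc : open (img c) by exact: img_open.
have H w := @Cr_slice R _ _ _ 2 (img c) _ w oc (Q_C2 ac).
exact: (CrB oc (CrB oc (H _) (H _)) (H _)).
Qed.

Lemma chart_metric_pos c y w : atlas c -> img c y -> w != 0 ->
  0 < bform (fun i j => chart_metric c i j y) w w.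
Proof.
move=> ac iy w0; have := chart_metricE c y w.
have [_ pos] := Q_posdef (cinv c y).
have : 0 < Q (cinv c y) (from_chart c y w).
  by apply: pos; apply: contra w0 => /eqP /(from_chart_inj0 ac iy) ->.
lra.
Qed.

Lemma chart_map_Cr c : atlas c -> Cr 3 (img c) (chart_map c).
Proof. by move=> ac; exact: F_C3. Qed.

Lemma chart_potential_Cr c : atlas c -> Cr 2 (img c) (chart_potential c).
Proof.
move=> ac; have oc : open (img c) by exact: img_open.
have cG := Cr_le (leqnSn 2) (chart_map_Cr ac).
exact: (Cr_comp oc (fun y _ => I : setT (chart_map c y)) cG g_C2).
Qed.

Lemma pullback_from_chart c y w : atlas c -> img c y ->
  pullback F omega (cinv c y) (from_chart c y w) =
  omega (chart_map c y) ('d (chart_map c) y w).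
Proof.
move=> ac iy; rewrite /pullback; congr (omega _ _).
apply: tdiff_from_chart => // d ad.
by apply: Cr_le (F_C3 ad).
Qed.

Lemma local_lagrangianE c y w : atlas c -> img c y ->
  local_lagrangian magnetic_lagrangian c y w = chart_lagrangian c y w.
Proof.
move=> ac iy; rewrite /local_lagrangian /magnetic_lagrangian /TNinv /=.
by rewrite pullback_from_chart // (pullback_lform _ somega) chart_metricE.
Qed.

Lemma local_lagrangian_differentiable c z w : atlas c -> img c z ->
  differentiable (uncurried (local_lagrangian magnetic_lagrangian c)) (z, w).
Proof.
move=> ac iz; have oc : open (img c) by exact: img_open.
have d := mech_differentiable oc (fun i j => @chart_metric_Cr c i j ac)
  (pullback_coef_Cr oc (chart_map_Cr ac) somega) (chart_potential_Cr ac) w iz.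
have nE : {near (z, w), uncurried (chart_lagrangian c) =1
    uncurried (local_lagrangian magnetic_lagrangian c)}.
  have : \forall q \near (z, w), img c q.1.
    by apply: (@open_nbhs_nbhs _ (z, w) [set q | img c q.1]); split => //; exact: open_fst.
  by apply: filterS => -[y v] /= iy; rewrite /uncurried /= local_lagrangianE.
by have [] := near_eq_is_diff nE d.
Qed.

Lemma ext_deriv_pullback p v w :
  ext_deriv (pullback F omega) p v w =
  ext_deriv_Rk omega (F p) (tdiff F p v) (tdiff F p w).
Proof.
rewrite /ext_deriv; set c := chart_at p; have ac : atlas c by exact: chart_at_atlas.
have oc : open (img c) by exact: img_open.
have ip : img c (cmap c p) by apply: cmap_img; exact: chart_at_dom.
have E a b : 'd ((fun y u => pullback F omega (cinv c y) (from_chart c y u)) ^~ b) (cmap c p) a =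
    'D_a (fun z => omega (chart_map c z) ('d (chart_map c) z b)) (cmap c p).
  have d := pullback_differentiable oc (chart_map_Cr ac) somega b ip.
  have nE : {near cmap c p, (fun z => omega (chart_map c z) ('d (chart_map c) z b)) =1
      (fun y => pullback F omega (cinv c y) (from_chart c y b))}.
    have : \forall y \near cmap c p, img c y by exact: open_nbhs_nbhs.
    by apply: filterS => y iy; rewrite pullback_from_chart.
  have [_ E] := near_eq_is_diff nE d.
  exact: (etrans (congr1 (@^~ a) E) (esym (deriveE a d))).
rewrite !E (pullback_diff_bracket oc (chart_map_Cr ac) somega v w ip).
have GE : chart_map c (cmap c p) = F p by rewrite /chart_map /= cmapK //; exact: chart_at_dom.
by rewrite GE.
Qed.

End LagrangianInCharts.

(** * Vanishing of the differential at a minimum *)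

Section Minimum.
Context {R : realType} {k : nat}.

Lemma diff_at_min (g : 'rV[R]_k -> R) a z : (forall y, differentiable g y) ->
  (forall y, g a <= g y) -> 'd g a z = 0.
Proof.
move=> dg gmin; pose f (s : R) := g (a + s *: z).
have df (s : R) : is_derive s (1:R) f ('d g (a + s *: z) z) by exact: is_derive_line.
have H : is_derive (0:R) (1:R) f 0.
  apply: (@derive1_at_min R f (-1) 1 0).
  - lra.
  - by move=> t _; case: (df t).
  - by rewrite in_itv /=; apply/andP; split; lra.
  by move=> t _; rewrite /f scale0r addr0; exact: gmin.
have [_ E1] := df 0; have [_ E2] := H.
by rewrite E2 scale0r addr0 in E1; exact: esym.
Qed.

End Minimum.

(** * Equilibrium and instability over the zero level *)

Section Stability.
Context {R : realType} {n k : nat} {N : manifold R n}.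
Variables (Q : N -> 'rV[R]_n -> R) (g : 'rV[R]_k -> R) (F : N -> 'rV[R]_k).
Variable omega : 'rV[R]_k -> 'rV[R]_k -> R.
Hypothesis Q_posdef : posdef_quadratic_on_TN Q.
Hypothesis Q_C2 : CrTN 2 Q.
Hypothesis k_lt : (k < n)%N.
Hypothesis g_C2 : Cr 2 setT g.
Hypothesis g_ge0 : forall y, 0 <= g y.
Hypothesis g0 : g 0 = 0.
Hypothesis F_C3 : CrM 3 F.
Hypothesis F_reg : regular_value F 0.
Hypothesis somega : smooth_one_form omega.
Variable p : N.
Hypothesis Fp : F p = 0.

Local Notation L := (magnetic_lagrangian Q g F omega).

Let dg y : differentiable g y.
Proof. by have [+ _] := g_C2; exact. Qed.

Lemma diff_chart_potential c y v : atlas c -> img c y ->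
  'd (chart_potential g F c) y v = 'd g (chart_map F c y) ('d (chart_map F c) y v).
Proof.
move=> ac iy; have dG : differentiable (chart_map F c) y.
  by have [+ _] := chart_map_Cr F_C3 ac; exact.
exact: (congr1 (@^~ v) (diff_comp dG (dg _))).
Qed.

Lemma chart_potential_critical c v : atlas c -> dom c p ->
  'd (chart_potential g F c) (cmap c p) v = 0.
Proof.
move=> ac dp; have ip := cmap_img dp.
apply: (etrans (diff_chart_potential v ac ip)).
have -> : chart_map F c (cmap c p) = 0 by rewrite /chart_map /= cmapK.
by apply: diff_at_min => // y; rewrite g0.
Qed.

(** Along the constant curve the momentum is constant and the force reduces to minus the
    differential of the potential, which vanishes because [g] is minimal at [0]. *)
Lemma zero_equilibrium : equilibrium L (p, 0).
Proof.
exists (fun=> p); split; last first.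
  move=> t; congr (_, _); exact: derive1_cst.
split=> [t _|c ac]; first exact: cvg_cst.
split; first exact: Cr_cst.
move=> t [_ dp] v; have ip := cmap_img dp; have oc : open (img c) by exact: img_open.
have d0 s : derive1 (cmap c \o (fun=> p) : R -> 'rV[R]_n) s = 0 by exact: derive1_cst.
have nE : \forall z \near cmap c p, chart_lagrangian Q g F omega c z 0 =
    local_lagrangian L c z (derive1 (cmap c \o (fun=> p) : R -> 'rV[R]_n) t).
  have : \forall z \near cmap c p, img c z by exact: open_nbhs_nbhs.
  by apply: filterS => z iz; rewrite d0 local_lagrangianE.
have E := near_eq_derive v nE.
rewrite -[X in is_derive _ _ _ X]E.
have -> : 'D_v ((chart_lagrangian Q g F omega c)^~ 0) (cmap c p) = 0.
  rewrite (mech_derive_fst (fun i j => @chart_metric_Cr R n N Q Q_C2 c i j ac)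
    (pullback_coef_Cr oc (chart_map_Cr F_C3 ac) somega)
    (chart_potential_Cr g_C2 F_C3 ac) 0 v ip).
  rewrite /mech_force [X in _ - X]chart_potential_critical // subr0.
  rewrite /bform big1 ?mulr0 ?add0r; last first.
    by move=> i _; rewrite big1 // => j _; rewrite !mxE !mulr0.
  by rewrite /lform big1 // => i _; rewrite mxE mulr0.
rewrite (_ : (fun s => _) = fun=> 'D_v (fun w => local_lagrangian L c (cmap c p) w) 0).
  exact: is_derive_cst.
by apply/funext => s; rewrite d0.
Qed.

Lemma zero_unstable : lyapunov_unstable L (p, 0).
Proof.
pose c := chart_at p; pose y0 := cmap c p.
have ac : atlas c by exact: chart_at_atlas.
have dp : dom c p by exact: chart_at_dom.
have ip : img c y0 by exact: cmap_img.
have oc : open (img c) by exact: img_open.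
have cG := chart_map_Cr F_C3 ac.
have G0 : chart_map F c y0 = 0 by rewrite /chart_map /y0 /= cmapK.
have surj z : exists w, 'd (chart_map F c) y0 w = z.
  by have [w <-] := F_reg Fp z; exists w.
have [v [cv v0 Gv]] := kernel_field oc ip (Cr_le (leqnSn 2) cG) k_lt surj.
have cB i j := @chart_metric_Cr R n N Q Q_C2 c i j ac.
have cm := pullback_coef_Cr oc cG somega.
have cu := chart_potential_Cr g_C2 F_C3 ac.
have Bsym i j y (_ : img c y) := chart_metric_sym Q c i j y.
have Bpos y w (iy : img c y) := @chart_metric_pos R n N Q Q_posdef c y w ac iy.
have u_ge0 y (_ : img c y) : 0 <= chart_potential g F c y by exact: g_ge0.
have u0 : chart_potential g F c y0 = 0 by rewrite /chart_potential G0.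
have du_v y : img c y -> 'd (chart_potential g F c) y (v y) = 0.
  move=> iy; apply: (etrans (diff_chart_potential (v y) ac iy)).
  by rewrite (Gv y iy) linear0.
have m_v y : img c y -> lform ((pullback_coef (chart_map F c) omega) ^~ y) (v y) = 0.
  move=> iy; rewrite -(pullback_lform _ somega) (Gv y iy) (omega_sum somega) big1 // => j _.
  by rewrite mxE mul0r.
have dm_v y w : img c y ->
    lform (fun i => 'd (pullback_coef (chart_map F c) omega i) y (v y)) w =
    lform (fun i => 'd (pullback_coef (chart_map F c) omega i) y w) (v y).
  move=> iy; apply/eqP; rewrite -subr_eq0; apply/eqP.
  rewrite (pullback_closed oc cG somega (v y) w iy) (Gv y iy).
  exact: ext_deriv_Rk0l.
have [d d0 esc] := mech_escape oc cB cm cu Bsym Bpos ip cv v0 u_ge0 u0 du_v m_v dm_v.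
move=> stable.
(* The neighbourhood restricts positions only, but includes the chart domain, so a motion remaining
   in it never leaves the chart. *)
pose V : set (TN N) := [set z | dom c z.1 /\ `|cmap c z.1 - y0| < d].
have nV : nbhsTN (p, 0) V.
  rewrite /nbhsTN /= -/c -/y0.
  have near_fst (P : set 'rV[R]_n) : nbhs y0 P ->
      \forall q \near ((y0, 0) : 'rV[R]_n * 'rV[R]_n), P q.1.
    by move=> h; apply: cvg_fst.
  have h1 := near_fst _ (open_nbhs_nbhs (conj oc ip)).
  have h2 := near_fst _ (nbhsx_ballx y0 d d0).
  apply: filterS2 h1 h2 => q iq bq; split; first exact: cinv_dom.
  by rewrite /= cinvK // distrC; move: bq; rewrite -ball_normE.
have [W [nW HW]] := stable V nV.
(* Whatever neighbourhood [W] stability offers, slow enough initial velocities along [v y0] belong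
   to it, since [s *: v y0] tends to [0] with [s]. *)
have [s s0 Os] : exists2 s, 0 < s & W (p, s *: v y0).
  have cs : {for (0:R), continuous (fun s : R => (y0, s *: v y0))}.
    apply: differentiable_continuous; apply: differentiable_pair.
      exact: differentiable_cst.
    by apply: differentiableZl.
  have : \forall s \near (0:R), W (TNinv c (y0, s *: v y0)).
    have nW0 : nbhs ((y0, (0:R) *: v y0) : 'rV[R]_n * 'rV[R]_n) [set q | W (TNinv c q)].
      by rewrite scale0r; exact: nW.
    exact: (cs _ nW0).
  move=> /nbhs_ballP[e /= e0 He].
  exists (e / 2); first by rewrite divr_gt0.
  have := He (e / 2); rewrite -ball_normE /= sub0r normrN gtr0_norm ?divr_gt0 //.
  move=> /(_ _); rewrite /TNinv /= /y0 from_chart_at cmapK //; apply; lra.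
have [T [T0 [y [yy0 dy0 cy Hy]]]] := mech_solution oc cB cm cu Bsym Bpos (s *: v y0) ip.
have el0 : EL_solution L [set t | `|t| < T] (cinv c \o y).
  apply: (@chart_EL_solution R n N L c (chart_lagrangian Q g F omega c) T y ac _ _ cy).
  - by move=> x w ix; rewrite local_lagrangianE.
  - by move=> d' z w ad iz; exact: local_lagrangian_differentiable.
  move=> t tT; have [h1 h2 h3 h4] := Hy t tT; split => //.
  by exists (accel (chart_metric Q c) (pullback_coef (chart_map F c) omega) (chart_potential g F c) (y t) (derive1 y t)).
have oI0 : open [set t : R | `|t| < T].
  rewrite (_ : [set t | _] = ball (0:R) T) //; first exact: ball_open.
  by apply/seteqP; split=> x /=; rewrite -ball_normE /= sub0r normrN.
have iI0 : is_interval [set t : R | `|t| < T].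
  move=> a b /=; rewrite !ltr_norml => /andP[a1 a2] /andP[b1 b2] x /andP[ax xb].
  by rewrite ltr_norml; apply/andP; split; lra.
have I00 : `|0 : R| < T by rewrite normr0.
(* The chart solution lives on a short interval, whereas stability only speaks of maximal
   solutions. *)
have [J [gam [maxJ IJ gamE]]] := maximal_extension oI0 iI0 I00 el0.
have [oJ iJ J0 elJ _] := maxJ.
have gam0 : gam 0 = p by rewrite gamE //= yy0 /y0 cmapK.
pose Y := cmap c \o gam : R -> 'rV[R]_n.
have nY : \forall t \near (0:R), y t = Y t.
  have : \forall t \near (0:R), `|t| < T by exact: open_nbhs_nbhs.
  apply: filterS => t tT; rewrite /Y /= gamE //= cinvK //.
  by case: (Hy t tT).
have Y0 : Y 0 = y0 by rewrite /Y /= gam0.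
have dY0 : derive1 Y 0 = s *: v y0.
  by rewrite -dy0 !derive1E; apply: esym; exact: near_eq_derive.
have lift0 : velocity_lift gam 0 = (p, s *: v y0).
  by rewrite /velocity_lift gam0 -/c -/Y dY0.
have Hst := HW J gam maxJ; rewrite lift0 in Hst; have {}Hst := Hst Os.
(* Stability puts every [t >= 0] in [J] and the motion in [V], so the equations hold in this one
   chart for all positive times, as [mech_escape] requires; its conclusion contradicts the strict
   bound in [V]. *)
have [t t0] : exists2 t, 0 <= t & d <= `|Y t - y0|.
  apply: (esc s Y s0 Y0 dY0) => t t0.
  have [Jt [dt _]] := Hst t t0; rewrite /= in dt.
  have [h1 h2 h3] := EL_chart_derive oJ elJ ac Jt dt.
  have iY : img c (Y t) by exact: cmap_img.
  split => //.
  have nYY : \forall x \near t, Y x = Y x by apply: filterE.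
  apply: (EL_at_near oc iY (is_derive_continuous h1) _ nYY h3) => x w ix.
  exact: local_lagrangianE.
by have [_ [_ /=]] := Hst t t0; rewrite ltNge => /negP.
Qed.

End Stability.

Theorem corollary3 (R : realType) (n : nat) (N : manifold R n)
  (Q : N -> 'rV[R]_n -> R)
  (Q_posdef : posdef_quadratic_on_TN Q) (Q_C2 : CrTN 2 Q)
  (k : nat) (k_ge1 : (1 <= k)%N) (k_lt : (k < n)%N)
  (g : 'rV[R]_k -> R)
  (g_C2 : Cr 2 setT g)
  (g_ge0 : forall y, 0 <= g y) (g_eq0 : forall y, g y = 0 <-> y = 0)
  (F : N -> 'rV[R]_k)
  (F_C3 : CrM 3 F)
  (F_reg : regular_value F 0)
  (F_comm : forall i j x,
     grad Q (component F i) x != 0 -> grad Q (component F j) x != 0 ->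
     lie_bracket (normalized_grad Q (component F i))
                 (normalized_grad Q (component F j)) x = 0)
  (F_orth : forall i j x, i != j ->
     metric Q x (grad Q (component F i) x) (grad Q (component F j) x) = 0) :
  let U : N -> R := fun x => g (F x) in
  let M : set N := [set x | U x = 0] in
  let L (mu : N -> 'rV[R]_n -> R) : N -> 'rV[R]_n -> R :=
    fun x v => Q x v + mu x v - U x in
  [/\ forall omega, smooth_one_form omega ->
        forall p, M p ->
          equilibrium (L (pullback F omega)) (p, 0) /\
          lyapunov_unstable (L (pullback F omega)) (p, 0),
      forall omega, smooth_one_form omega ->
        non_null (ext_deriv_Rk omega 0) ->
        forall p, M p -> non_null (ext_deriv (pullback F omega) p) &
      (1 < k)%N ->
        exists omega, smooth_one_form omega /\
          forall p, M p -> non_null (ext_deriv (pullback F omega) p)].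
Proof.
move=> U M L.
have MF p : M p -> F p = 0 by move=> /g_eq0.
have g0 : g 0 = 0 by apply/g_eq0.
have nonnull omega : smooth_one_form omega -> non_null (ext_deriv_Rk omega 0) ->
    forall p, M p -> non_null (ext_deriv (pullback F omega) p).
  move=> somega [a [b ab]] p /MF Fp.
  (* Regularity of the value [0] lifts a pair of vectors on which [ext_deriv_Rk omega 0] is nonzero
     to tangent vectors at [p]. *)
  have [v va] := F_reg p Fp a; have [w wb] := F_reg p Fp b.
  by exists v, w; rewrite (ext_deriv_pullback F_C3 somega) Fp va wb.
split => // [omega somega p /MF Fp|k_gt1].
  split; first exact: zero_equilibrium.
  exact: zero_unstable.
pose i0 : 'I_k := Ordinal k_ge1; pose i1 : 'I_k := Ordinal k_gt1.
(* The form [y_0 dy_1], whose exterior derivative [dy_0 /\ dy_1] takes the value 1 on the first two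
   basis vectors. *)
pose omega (y v : 'rV[R]_k) : R := y 0 i0 * v 0 i1.
have somega : smooth_one_form omega.
  split=> [y a u v|v r]; first by rewrite /omega !mxE mulrDr mulrCA.
  apply: (Cr_mul openT _ (Cr_cst _ _ _)).
  exact: (Cr_coord i0 openT (Cr_id _ _)).
exists omega; split => //; apply: nonnull => //.
have E (a b : 'rV[R]_k) : 'd (omega ^~ b : 'rV[R]_k -> R) 0 a = a 0 i0 * b 0 i1.
  have [_ /(_ b 1)[/(_ 0 Logic.I) do_ _]] := somega.
  have H := is_derive_mul (is_derive_coordV 0 a i0) (is_derive_cst (b 0 i1) 0 a).
  rewrite -deriveE //; apply: (etrans (@derive_val _ _ _ _ _ _ _ H)).
  by rewrite mulr0 addr0.
exists (delta_mx 0 i0), (delta_mx 0 i1).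
have i01 : (i0 == i1) = false by [].
have i10 : (i1 == i0) = false by [].
rewrite /ext_deriv_Rk (E (delta_mx 0 i0)) (E (delta_mx 0 i1)) !mxE !eqxx i01 i10.
by rewrite mulr1 mulr0 subr0 oner_neq0.
Qed.
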